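(* Let $\nu\in\mathbb{R}$ and $-\nu<u^1<u^2<u^3$. Put $R(\lambda)=(\lambda+\nu)(\lambda-u^1)(\lambda-u^2)(\lambda-u^3)$, $k=2\pi\left(\oint_a(\lambda+\nu)d\lambda/\sqrt{R(\lambda)}\right)^{-1}$ ($a$ a cycle on $y^2=R(\lambda)$ encircling $[u^1,u^2]$), $\omega=(2\nu+u^1+u^2+u^3)k$, and $C^i=\partial_{u^i}\omega/\partial_{u^i}k$, $i=1,2,3$ (these are the characteristic speeds of the one-phase Whitham modulation equations $\partial_tu^i+C^i(\boldsymbol u)\partial_xu^i=0$ of the Camassa--Holm equation ${\tt u}_t+3{\tt u}{\tt u}_x={\tt u}_{xxt}+2{\tt u}_x{\tt u}_{xx}+{\tt u}{\tt u}_{xxx}-2\nu{\tt u}_x$ in Riemann invariants). Then $$C^1=u^1+u^2+u^3+2\nu+\frac{2(u^1+\nu)(u^1-u^2)\Lambda(K(s),\rho,s)}{(u^2+\nu)[K(s)-E(s)]},$$ $$C^2=u^1+u^2+u^3+2\nu+\frac{2(u^2-u^1)\Lambda(K(s),\rho,s)}{K(s)-\dfrac{(u^2+\nu)(u^3-u^1)}{(u^1+\nu)(u^3-u^2)}E(s)},$$ $$C^3=u^1+u^2+u^3+2\nu+\frac{2(u^1+\nu)(u^3-u^2)\Lambda(K(s),\rho,s)}{(u^2+\nu)E(s)},$$ where $s^2=\dfrac{(u^2-u^1)(u^3+\nu)}{(u^3-u^1)(u^2+\nu)}$ and $\rho^2=\dfrac{u^2-u^1}{u^2+\nu}$. The equations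 $\partial_tu^i+C^i(\boldsymbol u)\partial_xu^i=0$ are hyperbolic, and for $-\nu<u^1<u^2<u^3$ the speeds satisfy $C^1(\boldsymbol u)<C^3(\boldsymbol u)$ and $C^2(\boldsymbol u)<C^3(\boldsymbol u)$. In the limit when two Riemann invariants coalesce, the modulation equations reduce to the dispersionless Camassa--Holm equation $\partial_t{\tt u}+(3{\tt u}+2\nu)\partial_x{\tt u}=0$ (namely, when $u^2,u^3\to v$ one has $C^2=C^3$ in the limit and $C^1\to3u^1+2\nu$; when $u^1,u^2$ coalesce one has $C^1=C^2$ in the limit and $C^3\to3u^3+2\nu$).
   Context: $K(s)=\int_0^{\pi/2}d\psi/\sqrt{1-s^2\sin^2\psi}$ and $E(s)=\int_0^{\pi/2}\sqrt{1-s^2\sin^2\psi}\,d\psi$ are the complete elliptic integrals of the first and second kind with modulus $s$, and $\Lambda(K(s),\rho,s)=\int_0^{K(s)}\frac{dv}{1-\rho^2\,\mathrm{sn}^2 v}$ is the complete elliptic integral of the third kind, with $\mathrm{sn}$ the Jacobi elliptic function of modulus $s$. *)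

(* Defs.v *)
From Stdlib Require Import Reals ClassicalEpsilon.
From Coquelicot Require Import Coquelicot.
Open Scope R_scope.

Definition Kell (s : R) : R :=
  RInt (fun psi => / sqrt (1 - s ^ 2 * sin psi ^ 2)) 0 (PI / 2).
Definition Eell (s : R) : R :=
  RInt (fun psi => sqrt (1 - s ^ 2 * sin psi ^ 2)) 0 (PI / 2).

Definition Finc (s phi : R) : R :=
  RInt (fun psi => / sqrt (1 - s ^ 2 * sin psi ^ 2)) 0 phi.
(* Jacobi amplitude: the inverse of phi |-> F(phi, s) (unique for 0 <= s < 1). *)
Definition am (s v : R) : R := epsilon (inhabits 0) (fun phi => Finc s phi = v).
Definition sn (s v : R) : R := sin (am s v).

Definition Lam (x rho s : R) : R :=
  RInt (fun v => / (1 - rho ^ 2 * sn s v ^ 2)) 0 x.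

Definition Rpol (nu u1 u2 u3 l : R) : R := (l + nu) * (l - u1) * (l - u2) * (l - u3).

(* The a-period  oint_a (lambda+nu) dlambda / sqrt(R(lambda)), the cycle a
   encircling [u1,u2], where R > 0: equal to twice the (improper) integral
   over (u1,u2). *)
Definition aper (nu u1 u2 u3 : R) : R :=
  2 * RInt_gen (fun l => (l + nu) / sqrt (Rpol nu u1 u2 u3 l)) (at_right u1) (at_left u2).

Definition kwave (nu u1 u2 u3 : R) : R := 2 * PI / aper nu u1 u2 u3.
Definition omega (nu u1 u2 u3 : R) : R := (2 * nu + u1 + u2 + u3) * kwave nu u1 u2 u3.

Definition Cspeed1 (nu u1 u2 u3 : R) : R :=
  Derive (fun x => omega nu x u2 u3) u1 / Derive (fun x => kwave nu x u2 u3) u1.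
Definition Cspeed2 (nu u1 u2 u3 : R) : R :=
  Derive (fun x => omega nu u1 x u3) u2 / Derive (fun x => kwave nu u1 x u3) u2.
Definition Cspeed3 (nu u1 u2 u3 : R) : R :=
  Derive (fun x => omega nu u1 u2 x) u3 / Derive (fun x => kwave nu u1 u2 x) u3.

Definition smod (nu u1 u2 u3 : R) : R :=
  sqrt ((u2 - u1) * (u3 + nu) / ((u3 - u1) * (u2 + nu))).
Definition rhop (nu u1 u2 : R) : R := sqrt ((u2 - u1) / (u2 + nu)).

(* Main.v *)
Require Import Defs.
From Stdlib Require Import Reals Lra ClassicalEpsilon.
From Coquelicot Require Import Coquelicot.
Open Scope R_scope.

(** Put [a = u1 + nu], [b = u2 + nu], [c = u3 + nu]. With [x = a + (b - a) sin^2 theta] the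
    a-period becomes the regular integral of [4 sqrt (x / (c - x))] over [[0, PI/2]], which can be
    differentiated under the integral sign. The substitution [tan theta = sqrt (a / b) tan t],
    i.e. [x = a / (1 - rho^2 sin^2 t)], turns the period into [4 a Lambda / sqrt (b (c - a))] and
    its partial derivatives into multiples of
      [D = int sin^2 / sqrt (1 - s^2 sin^2)], [B = int cos^2 / sqrt (1 - s^2 sin^2)] and [E].
    Since [C^i = S - A / d_i A] for the period [A], one gets
      [C^1 = S - 2 a (c - a) Lambda / (c D)], [C^2 = S - 2 a (c - b) Lambda / (c B)],
      [C^3 = S + 2 a (c - b) Lambda / (b E)],
    and the formulas of the theorem follow from [K - E = s^2 D] and [E - (1 - s^2) K = s^2 B].
    In particular [C^1, C^2 < S < C^3]. As [s -> 0], [B] and [D] tend to [PI/4]. As [s -> 1],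
    [B] stays in [[PI/4, 1]] while [D] diverges logarithmically, [Lambda = K / (1 - rho^2) + O(1)],
    and [(1 - s^2) K] tends to [0]. *)

(** * Complete elliptic integrals: algebraic relations and bounds *)

Definition ellK (m : R) : R := RInt (fun t => / sqrt (1 - m * sin t ^ 2)) 0 (PI / 2).
Definition ellE (m : R) : R := RInt (fun t => sqrt (1 - m * sin t ^ 2)) 0 (PI / 2).
(** The parameter [m] is the square of the modulus. [ellB] and [ellD] are the classical integrals
    [B] and [D]: positive quantities in which the differences of [K] and [E] from the theorem become
    single terms, so that signs and limits can be read off. *)
Definition ellB (m : R) : R :=
  RInt (fun t => cos t ^ 2 / sqrt (1 - m * sin t ^ 2)) 0 (PI / 2).
Definition ellD (m : R) : R :=
  RInt (fun t => sin t ^ 2 / sqrt (1 - m * sin t ^ 2)) 0 (PI / 2).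
(** Legendre form of the third-kind integral, with characteristic [n] in the place of [rho ^ 2]. *)
Definition ellPi (n m : R) : R :=
  RInt (fun t => / ((1 - n * sin t ^ 2) * sqrt (1 - m * sin t ^ 2))) 0 (PI / 2).

Lemma sin_sq_bounds (t : R) : 0 <= sin t ^ 2 <= 1.
Proof. generalize (sin2_cos2 t); unfold Rsqr; nra. Qed.

Lemma cos_sq (t : R) : cos t ^ 2 = 1 - sin t ^ 2.
Proof. generalize (sin2_cos2 t); unfold Rsqr; nra. Qed.

Lemma modulus_factor_pos (m t : R) : 0 <= m < 1 -> 0 < 1 - m * sin t ^ 2.
Proof. intros Hm; generalize (sin_sq_bounds t); nra. Qed.

Lemma modulus_sqrt_pos (m t : R) : 0 <= m < 1 -> 0 < sqrt (1 - m * sin t ^ 2).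
Proof. intros Hm; apply sqrt_lt_R0, modulus_factor_pos, Hm. Qed.

Lemma modulus_sqrt_sq (m t : R) : 0 <= m < 1 ->
  sqrt (1 - m * sin t ^ 2) * sqrt (1 - m * sin t ^ 2) = 1 - m * sin t ^ 2.
Proof. intros Hm; apply sqrt_sqrt, Rlt_le, modulus_factor_pos, Hm. Qed.

Lemma ex_RInt_smooth (f : R -> R) (a b : R) : (forall t, ex_derive f t) -> ex_RInt f a b.
Proof.
  intros Hf; apply (ex_RInt_continuous (V := R_CompleteNormedModule)).
  intros t _; apply (ex_derive_continuous f t), Hf.
Qed.

Ltac ell_side :=
  repeat match goal with
  | |- _ /\ _ => split
  | |- True => exact I
  (* [sin t * (sin t * 1)] is the unfolded [sin t ^ 2] of the side conditions of [auto_derive]. The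
     inner match prevents the same positivity facts from being added again and again. *)
  | H : 0 <= ?m < 1 |- context [?m * (sin ?t * (sin ?t * 1))] =>
      lazymatch goal with
      | _ : 0 < 1 - m * sin t ^ 2 |- _ => fail
      | _ => pose proof (modulus_factor_pos m t H); pose proof (modulus_sqrt_pos m t H)
      end
  end; simpl in *; try lra;
  try (apply Rgt_not_eq; repeat apply Rmult_lt_0_compat; unfold Rminus in *; simpl in *; lra).

Ltac ell_smooth :=
  intros;
  match goal with
  | |- ex_RInt _ _ _ => apply ex_RInt_smooth; intros
  | |- continuous _ _ => apply (ex_derive_continuous (V := R_NormedModule))
  end;
  auto_derive; ell_side.

Lemma ex_RInt_ellK m a b : 0 <= m < 1 -> ex_RInt (fun t => / sqrt (1 - m * sin t ^ 2)) a b.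
Proof. ell_smooth. Qed.
Lemma ex_RInt_ellE m a b : 0 <= m < 1 -> ex_RInt (fun t => sqrt (1 - m * sin t ^ 2)) a b.
Proof. ell_smooth. Qed.
Lemma ex_RInt_ellB m a b : 0 <= m < 1 ->
  ex_RInt (fun t => cos t ^ 2 / sqrt (1 - m * sin t ^ 2)) a b.
Proof. ell_smooth. Qed.
Lemma ex_RInt_ellD m a b : 0 <= m < 1 ->
  ex_RInt (fun t => sin t ^ 2 / sqrt (1 - m * sin t ^ 2)) a b.
Proof. ell_smooth. Qed.
Lemma ex_RInt_ellPi n m a b : 0 <= n < 1 -> 0 <= m < 1 ->
  ex_RInt (fun t => / ((1 - n * sin t ^ 2) * sqrt (1 - m * sin t ^ 2))) a b.
Proof. ell_smooth. Qed.

Lemma RInt_sin_sq : RInt (fun t => sin t ^ 2) 0 (PI / 2) = PI / 4.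
Proof.
  apply is_RInt_unique.
  replace (PI / 4) with (minus ((PI / 2 - sin (PI / 2) * cos (PI / 2)) / 2)
                               ((0 - sin 0 * cos 0) / 2))
    by (rewrite cos_PI2, sin_0; unfold minus, plus, opp; simpl; field).
  apply (is_RInt_derive (V := R_CompleteNormedModule) (fun t => (t - sin t * cos t) / 2)).
  - intros t _; auto_derive; [trivial|]. generalize (cos_sq t); nra.
  - ell_smooth.
Qed.

Lemma RInt_cos_sq : RInt (fun t => cos t ^ 2) 0 (PI / 2) = PI / 4.
Proof.
  apply is_RInt_unique.
  replace (PI / 4) with (minus ((PI / 2 + sin (PI / 2) * cos (PI / 2)) / 2)
                               ((0 + sin 0 * cos 0) / 2))
    by (rewrite cos_PI2, sin_0; unfold minus, plus, opp; simpl; field).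
  apply (is_RInt_derive (V := R_CompleteNormedModule) (fun t => (t + sin t * cos t) / 2)).
  - intros t _; auto_derive; [trivial|]. generalize (cos_sq t); nra.
  - ell_smooth.
Qed.

Lemma RInt_cos_quarter : RInt cos 0 (PI / 2) = 1.
Proof.
  apply is_RInt_unique.
  replace 1 with (minus (sin (PI / 2)) (sin 0))
    by (rewrite sin_PI2, sin_0; unfold minus, plus, opp; simpl; ring).
  apply (is_RInt_derive (V := R_CompleteNormedModule) sin).
  - intros t _; auto_derive; [trivial|]. ring.
  - ell_smooth.
Qed.

Lemma half_PI_pos : 0 < PI / 2.
Proof. generalize PI_RGT_0; lra. Qed.

Lemma ellK_eq m : 0 <= m < 1 -> ellK m = ellB m + ellD m.
Proof.
  intros Hm; unfold ellK, ellB, ellD.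
  rewrite <- (RInt_plus (V := R_CompleteNormedModule)).
  2: now apply ex_RInt_ellB. 2: now apply ex_RInt_ellD.
  apply RInt_ext; intros t _; unfold plus; simpl.
  generalize (modulus_sqrt_pos m t Hm) (cos_sq t); simpl; intros Hp Hc; field_simplify_eq; [|lra].
  lra.
Qed.

Lemma ellE_eq m : 0 <= m < 1 -> ellE m = ellB m + (1 - m) * ellD m.
Proof.
  intros Hm; unfold ellE, ellB, ellD.
  rewrite <- (RInt_scal (V := R_CompleteNormedModule)) by now apply ex_RInt_ellD.
  rewrite <- (RInt_plus (V := R_CompleteNormedModule)).
  2: now apply ex_RInt_ellB.
  2: apply (ex_RInt_scal (V := R_NormedModule)); now apply ex_RInt_ellD.
  apply RInt_ext; intros t _; unfold plus, scal; simpl; unfold mult; simpl.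
  generalize (modulus_sqrt_pos m t Hm) (modulus_sqrt_sq m t Hm) (cos_sq t); simpl.
  set (q := sqrt _); intros Hp Hs Hc; field_simplify_eq; [|lra].
  nra.
Qed.

(** Since [cos t <= sqrt (1 - m * sin t ^ 2) <= 1] on the quarter period, the integrand lies between
    [cos t ^ 2] and [cos t]. The bounds are uniform in [m], which controls [ellB] as [m] tends to
    1. *)
Lemma ellB_bounds m : 0 <= m < 1 -> PI / 4 <= ellB m <= 1.
Proof.
  intros Hm.
  assert (Hpt : forall t, 0 < t < PI / 2 ->
     cos t ^ 2 <= cos t ^ 2 / sqrt (1 - m * sin t ^ 2) <= cos t).
  { intros t Ht; generalize (modulus_sqrt_pos m t Hm) (modulus_sqrt_sq m t Hm)
      (cos_sq t) (sin_sq_bounds t) (cos_gt_0 t ltac:(lra) ltac:(lra)).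
    set (q := sqrt _); set (c := cos t); set (s := sin t); intros Hp Hs Hc Hb Hcp.
    assert (q <= 1) by nra.
    assert (c <= q) by nra.
    split; apply Rmult_le_reg_r with q; try lra;
      unfold Rdiv; rewrite Rmult_assoc, Rinv_l; nra. }
  split.
  - rewrite <- RInt_cos_sq; apply RInt_le;
      [apply Rlt_le, half_PI_pos|ell_smooth|now apply ex_RInt_ellB|].
    intros t Ht; apply (Hpt t Ht).
  - apply Rle_trans with (RInt cos 0 (PI / 2)); [|rewrite RInt_cos_quarter; lra].
    apply RInt_le; [apply Rlt_le, half_PI_pos|now apply ex_RInt_ellB|ell_smooth|].
    intros t Ht; apply (Hpt t Ht).
Qed.

Lemma modulus_sqrt_range m t : 0 <= m < 1 ->
  sqrt (1 - m) <= sqrt (1 - m * sin t ^ 2) <= 1.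
Proof.
  intros Hm; generalize (sin_sq_bounds t); intros Hb; split.
  - apply sqrt_le_1_alt; nra.
  - rewrite <- sqrt_1 at 2; apply sqrt_le_1_alt; nra.
Qed.

Lemma inv_modulus_range m t : 0 <= m < 1 ->
  1 <= / sqrt (1 - m * sin t ^ 2) <= / sqrt (1 - m).
Proof.
  intros Hm; destruct (modulus_sqrt_range m t Hm) as [H1 H2].
  assert (0 < sqrt (1 - m)) by (apply sqrt_lt_R0; lra).
  split.
  - rewrite <- Rinv_1 at 1; apply Rinv_le_contravar; lra.
  - apply Rinv_le_contravar; lra.
Qed.

(** Complements the uniform bound by 1: this one tends to [PI / 4] as [m] tends to 0 and serves the
    limit of small modulus. *)
Lemma ellB_le m : 0 <= m < 1 -> ellB m <= PI / 4 * / sqrt (1 - m).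
Proof.
  intros Hm; rewrite <- RInt_cos_sq, Rmult_comm; unfold ellB.
  rewrite <- (RInt_scal (V := R_CompleteNormedModule)) by ell_smooth.
  apply RInt_le; [apply Rlt_le, half_PI_pos|now apply ex_RInt_ellB| |].
  - apply (ex_RInt_scal (V := R_NormedModule)); ell_smooth.
  - intros t _; unfold scal; simpl; unfold mult; simpl.
    generalize (inv_modulus_range m t Hm) (pow2_ge_0 (cos t)); unfold Rdiv; simpl; nra.
Qed.

Lemma ellD_bounds m : 0 <= m < 1 -> PI / 4 <= ellD m <= PI / 4 * / sqrt (1 - m).
Proof.
  intros Hm; split.
  - rewrite <- RInt_sin_sq; unfold ellD.
    apply RInt_le; [apply Rlt_le, half_PI_pos| |now apply ex_RInt_ellD|].
    + ell_smooth.
    + intros t _.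
      generalize (inv_modulus_range m t Hm) (pow2_ge_0 (sin t)); unfold Rdiv; simpl; nra.
  - rewrite <- RInt_sin_sq, Rmult_comm; unfold ellD.
    rewrite <- (RInt_scal (V := R_CompleteNormedModule)) by ell_smooth.
    apply RInt_le; [apply Rlt_le, half_PI_pos|now apply ex_RInt_ellD| |].
    + apply (ex_RInt_scal (V := R_NormedModule)); ell_smooth.
    + intros t _; unfold scal; simpl; unfold mult; simpl.
      generalize (inv_modulus_range m t Hm) (pow2_ge_0 (sin t)); unfold Rdiv; simpl; nra.
Qed.

Lemma ellK_le m : 0 <= m < 1 -> ellK m <= PI / 2 * / sqrt (1 - m).
Proof.
  intros Hm; rewrite (ellK_eq m Hm).
  generalize (ellB_le m Hm) (ellD_bounds m Hm); lra.
Qed.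

(** With [e = sqrt (1 - m)] the radicand equals [cos t ^ 2 + e ^ 2 * sin t ^ 2], hence its root is
    at most [e + cos t]. Inserting the factor [sin t <= 1] yields a minorant with the primitive
    [- ln (e + cos t)]. *)
Lemma ellK_ge_log m : 0 <= m < 1 -> - ln (sqrt (1 - m)) <= ellK m.
Proof.
  intros Hm.
  assert (He : 0 < sqrt (1 - m)) by (apply sqrt_lt_R0; lra).
  assert (He2 : sqrt (1 - m) * sqrt (1 - m) = 1 - m) by (apply sqrt_sqrt; lra).
  set (e := sqrt (1 - m)) in *.
  assert (Hc : forall t, 0 <= t <= PI / 2 -> 0 <= cos t)
    by (intros t Ht; apply cos_ge_0; lra).
  assert (Hint : is_RInt (fun t => sin t / (e + cos t)) 0 (PI / 2)
                   (minus (- ln (e + cos (PI / 2))) (- ln (e + cos 0)))).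
  { apply (is_RInt_derive (V := R_CompleteNormedModule) (fun t => - ln (e + cos t)));
      intros t; rewrite Rmin_left, Rmax_right by (generalize half_PI_pos; lra); intros Ht;
      specialize (Hc t Ht).
    - auto_derive; [lra|field; lra].
    - ell_smooth. }
  apply Rle_trans with (RInt (fun t => sin t / (e + cos t)) 0 (PI / 2)).
  - rewrite (is_RInt_unique _ _ _ _ Hint), cos_PI2, cos_0, Rplus_0_r.
    unfold minus, plus, opp; simpl.
    assert (0 < ln (e + 1)) by (rewrite <- ln_1; apply ln_increasing; lra). lra.
  - apply RInt_le; [apply Rlt_le, half_PI_pos|eexists; apply Hint|now apply ex_RInt_ellK|].
    intros t Ht.
    assert (Hct : 0 < cos t) by (apply cos_gt_0; lra).
    generalize (modulus_sqrt_pos m t Hm) (modulus_sqrt_sq m t Hm) (cos_sq t) (sin_sq_bounds t).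
    set (q := sqrt _); set (c := cos t) in *; intros Hp Hs Hcs Hb.
    assert (Hs1 : sin t <= 1) by apply SIN_bound.
    assert (Hq : q <= e + c).
    { assert (q * q <= (e + c) * (e + c)) by nra. nra. }
    apply Rle_trans with (/ (e + c)).
    + unfold Rdiv; assert (0 < / (e + c)) by (apply Rinv_0_lt_compat; lra); nra.
    + apply Rinv_le_contravar; lra.
Qed.

(** The map [x => / (1 - n * x)] is increasing and convex on [[0, 1]]: it lies between its end
    values and above its tangent at [x = 1]. With [x = sin t ^ 2] the tangent produces the last
    bound, whose error term is a multiple of [ellB] and so stays bounded as [m] tends to 1. *)
Lemma ellPi_bounds n m : 0 <= n < 1 -> 0 <= m < 1 ->
  ellK m <= ellPi n m <= / (1 - n) * ellK m /\
  / (1 - n) * ellK m - n * / (1 - n) ^ 2 * ellB m <= ellPi n m.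
Proof.
  intros Hn Hm.
  assert (HK : / (1 - n) * ellK m = RInt (fun t => scal (/ (1 - n)) (/ sqrt (1 - m * sin t ^ 2)))
     0 (PI / 2)).
  { symmetry; apply (RInt_scal (V := R_CompleteNormedModule)); now apply ex_RInt_ellK. }
  assert (HB : n * / (1 - n) ^ 2 * ellB m = RInt (fun t => scal (n * / (1 - n) ^ 2)
     (cos t ^ 2 / sqrt (1 - m * sin t ^ 2))) 0 (PI / 2)).
  { symmetry; apply (RInt_scal (V := R_CompleteNormedModule)); now apply ex_RInt_ellB. }
  rewrite HK, HB; unfold ellK, ellPi.
  assert (Hpt : forall t, 1 <= / (1 - n * sin t ^ 2) <= / (1 - n) /\
            / (1 - n) - n * / (1 - n) ^ 2 * cos t ^ 2 <= / (1 - n * sin t ^ 2)).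
  { intros t; generalize (modulus_factor_pos n t Hn) (sin_sq_bounds t) (cos_sq t).
    intros Hp Hb Hc; split; [split|].
    - rewrite <- Rinv_1 at 1; apply Rinv_le_contravar; nra.
    - apply Rinv_le_contravar; nra.
    - rewrite Hc; set (x := sin t ^ 2) in *.
      (* The gap between the function and its tangent at 1, as an explicit nonnegative remainder. *)
      assert (/ (1 - n * x) - (/ (1 - n) - n * / (1 - n) ^ 2 * (1 - x))
              = n ^ 2 * (1 - x) ^ 2 * / (1 - n * x) * / (1 - n) ^ 2) by (field; lra).
      assert (0 <= n ^ 2 * (1 - x) ^ 2 * / (1 - n * x) * / (1 - n) ^ 2).
      { assert (0 < / (1 - n * x)) by (apply Rinv_0_lt_compat; lra).
        assert (0 < / (1 - n) ^ 2) by (apply Rinv_0_lt_compat, pow_lt; lra).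
        repeat apply Rmult_le_pos; try lra; apply pow2_ge_0. }
      lra. }
  split; [split|].
  - apply RInt_le; [apply Rlt_le, half_PI_pos|now apply ex_RInt_ellK|now apply ex_RInt_ellPi|].
    intros t _; rewrite Rinv_mult.
    destruct (Hpt t); generalize (inv_modulus_range m t Hm); nra.
  - apply RInt_le; [apply Rlt_le, half_PI_pos|now apply ex_RInt_ellPi| |].
    + apply (ex_RInt_scal (V := R_NormedModule)); now apply ex_RInt_ellK.
    + intros t _; rewrite Rinv_mult; unfold scal; simpl; unfold mult; simpl.
      destruct (Hpt t); generalize (inv_modulus_range m t Hm); simpl in *; nra.
  - match goal with |- ?x - ?y <= _ => change (x - y) with (minus x y) end.
    assert (HiK : ex_RInt (fun t => scal (/ (1 - n)) (/ sqrt (1 - m * sin t ^ 2))) 0 (PI / 2))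
      by (apply (ex_RInt_scal (V := R_NormedModule)); apply ex_RInt_ellK, Hm).
    assert (HiB : ex_RInt (fun t => scal (n * / (1 - n) ^ 2)
       (cos t ^ 2 / sqrt (1 - m * sin t ^ 2))) 0 (PI / 2))
      by (apply (ex_RInt_scal (V := R_NormedModule)); apply ex_RInt_ellB, Hm).
    rewrite <- (RInt_minus (V := R_CompleteNormedModule) _ _ _ _ HiK HiB).
    apply RInt_le; [apply Rlt_le, half_PI_pos| |now apply ex_RInt_ellPi|].
    + apply (ex_RInt_minus (V := R_NormedModule) _ _ _ _ HiK HiB).
    + intros t _; rewrite Rinv_mult; unfold scal, minus, plus, opp; simpl; unfold mult; simpl.
      destruct (Hpt t) as [_ H]; generalize (inv_modulus_range m t Hm); simpl in *.
      set (q := / sqrt _); intros Hq; unfold Rdiv; fold q.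
      match type of H with ?x <= ?y =>
        assert (0 <= (y - x) * q) by (apply Rmult_le_pos; lra) end.
      lra.
Qed.

(* [d/dt (m sin t cos t / sqrt y) = sqrt y - (1 - m) / y^(3/2)] with [y = 1 - m sin^2 t]. *)
Lemma RInt_modulus_cubed m : 0 <= m < 1 ->
  is_RInt (fun t => / ((1 - m * sin t ^ 2) * sqrt (1 - m * sin t ^ 2))) 0 (PI / 2)
    (ellE m / (1 - m)).
Proof.
  intros Hm.
  assert (H : is_RInt (fun t => sqrt (1 - m * sin t ^ 2)
     - (1 - m) / ((1 - m * sin t ^ 2) * sqrt (1 - m * sin t ^ 2))) 0 (PI / 2) 0).
  { evar_last.
    apply (is_RInt_derive (V := R_CompleteNormedModule)
             (fun t => m * sin t * cos t / sqrt (1 - m * sin t ^ 2))).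
    3: { rewrite cos_PI2, sin_0; unfold minus, plus, opp; simpl; unfold Rdiv; ring. }
    - intros t _.
      generalize (modulus_sqrt_pos m t Hm) (modulus_sqrt_sq m t Hm) (cos_sq t)
        (modulus_factor_pos m t Hm); intros Hp Hs Hc Hy.
      auto_derive; [ell_side|].
      replace (1 - m * (sin t * (sin t * 1))) with (1 - m * sin t ^ 2) in * by ring.
      set (q := sqrt _) in *.
      rewrite <- Hs in *.
      field_simplify_eq; [|lra].
      replace (cos t ^ 2) with (1 - sin t ^ 2) by lra.
      assert (Hm2 : m * sin t ^ 2 = 1 - q * q) by lra.
      replace (q ^ 4) with ((1 - m * sin t ^ 2) ^ 2) by (rewrite <- Hs; ring).
      replace (q ^ 2) with (1 - m * sin t ^ 2) by (rewrite <- Hs; ring).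
      ring.
    - ell_smooth. }
  apply is_RInt_ext with (fun t => scal (/ (1 - m)) (minus (sqrt (1 - m * sin t ^ 2))
    (sqrt (1 - m * sin t ^ 2)
     - (1 - m) / ((1 - m * sin t ^ 2) * sqrt (1 - m * sin t ^ 2))))).
  - intros t _; generalize (modulus_sqrt_pos m t Hm) (modulus_factor_pos m t Hm); intros.
    unfold scal, minus, plus, opp; simpl; unfold mult; simpl; simpl in *; field; lra.
  - replace (ellE m / (1 - m)) with (scal (/ (1 - m)) (minus (ellE m) 0))
      by (unfold scal, minus, plus, opp; simpl; unfold mult; simpl; field; lra).
    apply (is_RInt_scal (V := R_NormedModule)), (is_RInt_minus (V := R_NormedModule)).
    + apply (RInt_correct (V := R_CompleteNormedModule)); now apply ex_RInt_ellE.
    + exact H.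
Qed.

(** * The Jacobi amplitude and changes of variable in elliptic integrals *)

Lemma continuous_inv_modulus m t : 0 <= m < 1 ->
  continuous (fun t => / sqrt (1 - m * sin t ^ 2)) t.
Proof. ell_smooth. Qed.

Lemma continuous_inv_factor m t : 0 <= m < 1 -> continuous (fun t => / (1 - m * sin t ^ 2)) t.
Proof. ell_smooth. Qed.

Lemma is_derive_Finc s phi : 0 <= s ^ 2 < 1 ->
  is_derive (Finc s) phi (/ sqrt (1 - s ^ 2 * sin phi ^ 2)).
Proof.
  intros Hs; unfold Finc.
  apply (is_derive_RInt (V := R_NormedModule) (fun t => / sqrt (1 - s ^ 2 * sin t ^ 2)) _ 0).
  - apply filter_forall; intros t.
    apply (RInt_correct (V := R_CompleteNormedModule)), ex_RInt_ellK, Hs.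
  - apply continuous_inv_modulus, Hs.
Qed.

(** The derivative of [Finc s] is at least 1, so the mean value theorem applies. This one estimate
    gives injectivity, unboundedness and the continuity of the inverse. *)
Lemma Finc_expanding s x y : 0 <= s ^ 2 < 1 -> Rabs (x - y) <= Rabs (Finc s x - Finc s y).
Proof.
  intros Hs.
  destruct (MVT_gen (Finc s) y x (fun t => / sqrt (1 - s ^ 2 * sin t ^ 2))) as [c [_ Hc]].
  - intros t _; apply is_derive_Finc, Hs.
  - intros t _; apply derivable_continuous_pt; eexists; apply is_derive_Reals, is_derive_Finc, Hs.
  - rewrite Hc, Rabs_mult.
    destruct (inv_modulus_range _ c Hs) as [H1 _].
    rewrite (Rabs_pos_eq (/ _)) by lra.
    generalize (Rabs_pos (x - y)); nra.
Qed.

Lemma Finc_am s v : 0 <= s ^ 2 < 1 -> Finc s (am s v) = v.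
Proof.
  intros Hs; unfold am; apply epsilon_spec.
  assert (H0 : Finc s 0 = 0) by (unfold Finc; apply (RInt_point (V := R_CompleteNormedModule))).
  assert (Hmono : forall x y, x <= y -> Finc s x <= Finc s y).
  { intros x y Hxy; unfold Finc.
    rewrite <- (RInt_Chasles (V := R_CompleteNormedModule) _ 0 x y)
      by (apply ex_RInt_ellK, Hs).
    assert (0 <= RInt (fun psi => / sqrt (1 - s ^ 2 * sin psi ^ 2)) x y).
    { apply RInt_ge_0; [exact Hxy|apply ex_RInt_ellK, Hs|].
      intros t _; generalize (inv_modulus_range _ t Hs); lra. }
    unfold plus; simpl in *; lra. }
  (* By expansion from the fixed point 0, the values of [Finc s] at [- Rabs v] and [Rabs v] enclose
     [v], so the intermediate value theorem gives the preimage that [epsilon] needs. *)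
  pose proof (Finc_expanding s (Rabs v) 0 Hs) as Hp.
  pose proof (Finc_expanding s (- Rabs v) 0 Hs) as Hm.
  pose proof (Hmono 0 (Rabs v) (Rabs_pos v)) as Hp'.
  pose proof (Hmono (- Rabs v) 0 ltac:(generalize (Rabs_pos v); lra)) as Hm'.
  rewrite H0, !Rminus_0_r in *.
  rewrite (Rabs_pos_eq (Finc s (Rabs v))), Rabs_Rabsolu in Hp by lra.
  rewrite (Rabs_left1 (Finc s (- Rabs v))), Rabs_Ropp, Rabs_Rabsolu in Hm by lra.
  destruct (IVT_gen (Finc s) (- Rabs v) (Rabs v) v) as [x [_ Hx]].
  - intros t; apply derivable_continuous_pt; eexists; apply is_derive_Reals, is_derive_Finc, Hs.
  - assert (- Rabs v <= v <= Rabs v) by (unfold Rabs; destruct (Rcase_abs v); lra).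
    rewrite Rmin_left, Rmax_right; lra.
  - exists x; exact Hx.
Qed.

Lemma am_Finc s phi : 0 <= s ^ 2 < 1 -> am s (Finc s phi) = phi.
Proof.
  intros Hs.
  pose proof (Finc_expanding s (am s (Finc s phi)) phi Hs) as H.
  rewrite Finc_am, Rminus_diag, Rabs_R0 in H by exact Hs.
  generalize (Rabs_pos (am s (Finc s phi) - phi)); intros H'.
  assert (H0 : Rabs (am s (Finc s phi) - phi) = 0) by lra.
  apply Rabs_eq_0 in H0; lra.
Qed.

(** The inverse of an expanding map is 1-Lipschitz, so [eps] itself serves as the radius. *)
Lemma continuous_am s v : 0 <= s ^ 2 < 1 -> continuous (am s) v.
Proof.
  intros Hs; apply filterlim_locally; intros eps; exists eps; intros w Hw.
  apply Rle_lt_trans with (2 := Hw).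
  pose proof (Finc_expanding s (am s w) (am s v) Hs) as H.
  rewrite !Finc_am in H by exact Hs; exact H.
Qed.

(** Passage from the Jacobi form to the Legendre form by [v = Finc s t]: then [sn s v = sin t], and
    the upper limit [Kell s] corresponds to [t = PI / 2]. *)
Lemma Lam_complete s rho : 0 <= s ^ 2 < 1 -> 0 <= rho ^ 2 < 1 ->
  Lam (Kell s) rho s = ellPi (rho ^ 2) (s ^ 2).
Proof.
  intros Hs Hr; unfold Lam.
  assert (H0 : Finc s 0 = 0) by (unfold Finc; apply (RInt_point (V := R_CompleteNormedModule))).
  change (Kell s) with (Finc s (PI / 2)).
  rewrite <- H0 at 1.
  rewrite <- (RInt_comp (V := R_CompleteNormedModule) _ (Finc s)
               (fun t => / sqrt (1 - s ^ 2 * sin t ^ 2))).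
  - apply RInt_ext; intros t _; unfold sn; rewrite am_Finc by exact Hs.
    unfold scal; simpl; unfold mult; simpl.
    now rewrite <- Rinv_mult, Rmult_comm.
  - intros t _; unfold sn.
    apply (continuous_comp (am s) (fun x => / (1 - rho ^ 2 * sin x ^ 2))).
    + apply continuous_am, Hs.
    + apply continuous_inv_factor, Hr.
  - intros t _; split; [apply is_derive_Finc, Hs|].
    apply continuous_inv_modulus, Hs.
Qed.

(* The substitution [tan theta = k tan t], written as
   [theta = t + atan ((k-1) sin t cos t / (cos^2 t + k sin^2 t))] to avoid the pole at [PI/2]. *)
Lemma RInt_tan_scaling (g : R -> R) (k : R) : 0 < k ->
  (forall x, 0 <= x <= 1 -> continuous g x) ->
  RInt (fun t => g (sin t ^ 2)) 0 (PI / 2) =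
  RInt (fun t => k / (cos t ^ 2 + k ^ 2 * sin t ^ 2) *
                 g (k ^ 2 * sin t ^ 2 / (cos t ^ 2 + k ^ 2 * sin t ^ 2))) 0 (PI / 2).
Proof.
  intros Hk Hg.
  set (P := fun t => cos t ^ 2 + k * sin t ^ 2).
  set (Q := fun t => (k - 1) * sin t * cos t).
  set (D := fun t => cos t ^ 2 + k ^ 2 * sin t ^ 2).
  set (th := fun t => t + atan (Q t / P t)).
  assert (HP : forall t, 0 < P t)
    by (intros t; unfold P; generalize (cos_sq t) (sin_sq_bounds t); nra).
  (* [P + i Q] is the product of [cos t + i k sin t] and [cos t - i sin t]; the identity compares
     squared moduli, and [th t - t] is the argument of this product. *)
  assert (HD : forall t, P t ^ 2 + Q t ^ 2 = D t).
  { intros t; replace (D t) with ((cos t ^ 2 + sin t ^ 2) * D t)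
      by (rewrite cos_sq; ring).
    unfold P, Q, D; ring. }
  assert (HD0 : forall t, 0 < D t)
    by (intros t; rewrite <- HD; generalize (HP t) (pow2_ge_0 (Q t)); nra).
  assert (Hsin : forall t, sin (th t) ^ 2 = k ^ 2 * sin t ^ 2 / D t).
  { intros t; unfold th; rewrite sin_plus, sin_atan, cos_atan.
    replace (1 + Rsqr (Q t / P t)) with (D t / P t ^ 2)
      by (rewrite <- HD; unfold Rsqr; field; generalize (HP t); lra).
    rewrite sqrt_div_alt by (apply pow_lt, HP).
    rewrite sqrt_pow2 by (apply Rlt_le, HP).
    assert (Hr : 0 < sqrt (D t)) by (apply sqrt_lt_R0, HD0).
    pose proof (sqrt_sqrt (D t) (Rlt_le _ _ (HD0 t))) as Hrr.
    pose proof (HP t); pose proof (HD0 t).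
    replace (sin t * (1 / (sqrt (D t) / P t)) + cos t * (Q t / P t / (sqrt (D t) / P t)))
      with ((sin t * P t + cos t * Q t) / sqrt (D t)) by (field; lra).
    replace (sin t * P t + cos t * Q t) with (k * sin t * (cos t ^ 2 + sin t ^ 2))
      by (unfold P, Q; ring).
    set (r := sqrt (D t)) in *; clearbody r.
    rewrite cos_sq, <- Hrr; field; lra. }
  assert (Hd : forall t, is_derive th t (k / D t)).
  { intros t; pose proof (HP t) as HPt; pose proof (HD t) as HDt; pose proof (HD0 t) as HD0t.
    unfold th; evar_last.
    - apply (is_derive_plus (V := R_NormedModule)); [apply is_derive_id|].
      apply (is_derive_comp (V := R_NormedModule) atan (fun t => Q t / P t));
        [apply is_derive_atan|].
      apply (is_derive_div Q P t ((k - 1) * (cos t ^ 2 - sin t ^ 2)) (2 * (k - 1) * sin t * cos t)).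
      + unfold Q; auto_derive; [trivial|ring].
      + unfold P; auto_derive; [trivial|ring].
      + lra.
    - unfold plus, scal, one; simpl; unfold mult; simpl.
      replace (1 + Rsqr (Q t / P t)) with (D t / P t ^ 2)
        by (rewrite <- HDt; unfold Rsqr; field; lra).
      field_simplify_eq; [|lra].
      transitivity (cos t ^ 2 + k ^ 2 * sin t ^ 2 + (k - 1) *
        ((cos t ^ 2 - sin t ^ 2) * (cos t ^ 2 + k * sin t ^ 2)
         - 2 * (k - 1) * (cos t ^ 2 * sin t ^ 2))).
      + unfold P, Q, D; ring.
      + rewrite cos_sq; ring. }
  assert (Hth0 : th 0 = 0).
  { unfold th, Q; rewrite sin_0; replace ((k - 1) * 0 * cos 0 / P 0) with 0
      by (unfold Rdiv; ring). rewrite atan_0; ring. }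
  assert (Hth1 : th (PI / 2) = PI / 2).
  { unfold th, Q; rewrite cos_PI2; replace ((k - 1) * sin (PI / 2) * 0 / P (PI / 2)) with 0
      by (unfold Rdiv; ring). rewrite atan_0; ring. }
  rewrite <- Hth0 at 1; rewrite <- Hth1 at 1.
  rewrite <- (RInt_comp (V := R_CompleteNormedModule) (fun t => g (sin t ^ 2)) th
               (fun t => k / D t)).
  - apply RInt_ext; intros t _; rewrite Hsin; reflexivity.
  - intros t _; apply (continuous_comp (fun t => sin t ^ 2) g).
    + apply (ex_derive_continuous (V := R_NormedModule)); auto_derive; trivial.
    + apply Hg, sin_sq_bounds.
  - intros t _; split; [apply Hd|].
    apply (ex_derive_continuous (V := R_NormedModule)).
    pose proof (HD0 t); unfold D in *; auto_derive; simpl in *; lra.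
Qed.

(** * The a-period as a regular trigonometric integral *)

Definition period_integrand (a b c t : R) : R :=
  sqrt ((a + (b - a) * sin t ^ 2) / (c - (a + (b - a) * sin t ^ 2))).
Definition period_integral (a b c : R) : R := RInt (period_integrand a b c) 0 (PI / 2).

Lemma segment_range a b x : a < b -> 0 <= x <= 1 -> a <= a + (b - a) * x <= b.
Proof. intros; nra. Qed.

Lemma ex_derive_period_integrand a b c t : 0 < a -> a < b -> b < c ->
  ex_derive (period_integrand a b c) t.
Proof.
  intros Ha Hb Hc; unfold period_integrand.
  pose proof (segment_range a b _ Hb (sin_sq_bounds t)) as Hx.
  assert (0 < (a + (b - a) * sin t ^ 2) / (c - (a + (b - a) * sin t ^ 2)))
    by (apply Rdiv_lt_0_compat; lra).
  auto_derive; unfold Rdiv, Rminus in *; simpl in *; split; lra.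
Qed.

Lemma ex_RInt_period a b c p q : 0 < a -> a < b -> b < c ->
  ex_RInt (period_integrand a b c) p q.
Proof. intros; apply ex_RInt_smooth; intros; now apply ex_derive_period_integrand. Qed.

Lemma sin_sq_increasing x y : 0 <= x -> x <= y -> y <= PI / 2 -> sin x ^ 2 <= sin y ^ 2.
Proof.
  intros Hx Hxy Hy.
  assert (0 <= sin x) by (apply sin_ge_0; generalize PI_RGT_0; lra).
  assert (sin x <= sin y) by (apply sin_incr_1; lra).
  nra.
Qed.

(** The substitution [l = p + (q - p) * sin t ^ 2] absorbs inverse square root singularities at both
    ends. [h] is the continuous extension of the transformed integrand, hence the identity is asked
    for only at interior [t], where [f] is known to be continuous. *)
Lemma is_RInt_gen_trig_subst (f h : R -> R) (p q : R) : p < q ->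
  (forall l, p < l < q -> continuous f l) ->
  (forall t, continuous h t) ->
  (forall t, 0 < t < PI / 2 ->
     2 * (q - p) * sin t * cos t * f (p + (q - p) * sin t ^ 2) = h t) ->
  is_RInt_gen f (at_right p) (at_left q) (RInt h 0 (PI / 2)).
Proof.
  intros Hpq Hf Hh Hfh.
  pose proof half_PI_pos as Hpi.
  set (g := fun t => p + (q - p) * sin t ^ 2) in *.
  assert (Hexh : forall x y, ex_RInt h x y)
    by (intros x y; apply (ex_RInt_continuous (V := R_CompleteNormedModule)); intros; apply Hh).
  assert (Hg0 : g 0 = p) by (unfold g; rewrite sin_0; ring).
  assert (Hg1 : g (PI / 2) = q) by (unfold g; rewrite sin_PI2; ring).
  assert (Hmono : forall x y, 0 <= x -> x <= y -> y <= PI / 2 -> g x <= g y).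
  { intros x y Hx Hxy Hy; generalize (sin_sq_increasing x y Hx Hxy Hy); unfold g; nra. }
  assert (Hgin : forall t, 0 < t < PI / 2 -> p < g t < q).
  { intros t Ht; assert (0 < sin t) by (apply sin_gt_0; lra).
    assert (0 < cos t) by (apply cos_gt_0; lra).
    generalize (cos_sq t); unfold g; intros.
    assert (0 < cos t ^ 2) by (apply pow_lt; lra).
    assert (0 < sin t ^ 2) by (apply pow_lt; lra). split; nra. }
  (* Pulls the moving endpoints of the improper integral back to the variable [t]. *)
  assert (Hinv : forall x, p < x < q -> exists t, 0 < t < PI / 2 /\ g t = x).
  { intros x Hx; destruct (IVT_gen g 0 (PI / 2) x) as [t [Ht Hgt]].
    - intros t; apply derivable_continuous_pt; exists (2 * (q - p) * sin t * cos t).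
      apply is_derive_Reals; unfold g; auto_derive; [trivial|ring].
    - rewrite Hg0, Hg1, Rmin_left, Rmax_right; lra.
    - rewrite Rmin_left, Rmax_right in Ht by lra.
      exists t; split; [|exact Hgt].
      destruct (Req_dec t 0) as [->|]; [lra|].
      destruct (Req_dec t (PI / 2)) as [->|]; [lra|]. lra. }
  assert (Hsub : forall t1 t2, 0 < t1 < PI / 2 -> 0 < t2 < PI / 2 ->
            is_RInt f (g t1) (g t2) (RInt h t1 t2)).
  { intros t1 t2 H1 H2.
    assert (Hin : forall t, Rmin t1 t2 <= t <= Rmax t1 t2 -> 0 < t < PI / 2).
    { intros t [Ht Ht']; split.
      - apply Rlt_le_trans with (2 := Ht); apply Rmin_case; lra.
      - apply Rle_lt_trans with (1 := Ht'); apply Rmax_case; lra. }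
    replace (RInt h t1 t2) with (RInt f (g t1) (g t2)).
    - apply (RInt_correct (V := R_CompleteNormedModule)).
      apply (ex_RInt_continuous (V := R_CompleteNormedModule)); intros z [Hz Hz'].
      pose proof (Hgin t1 H1); pose proof (Hgin t2 H2).
      apply Hf; split.
      + apply Rlt_le_trans with (2 := Hz); apply Rmin_case; lra.
      + apply Rle_lt_trans with (1 := Hz'); apply Rmax_case; lra.
    - rewrite <- (RInt_comp (V := R_CompleteNormedModule) f g
                  (fun t => 2 * (q - p) * sin t * cos t)).
      + apply RInt_ext; intros t Ht; unfold scal; simpl; unfold mult; simpl.
        apply Hfh, Hin; lra.
      + intros t Ht; apply Hf, Hgin, Hin, Ht.
      + intros t Ht; split; [unfold g; auto_derive; [trivial|ring]|ell_smooth]. }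
  assert (Hcont : forall t0, continuous (fun t => RInt h 0 t) t0).
  { intros t0; apply (ex_derive_continuous (V := R_NormedModule)); exists (h t0).
    apply (is_derive_RInt (V := R_NormedModule) h _ 0).
    - apply filter_forall; intros t; apply (RInt_correct (V := R_CompleteNormedModule)), Hexh.
    - apply Hh. }
  intros P [eps HP].
  (* The integral over [[t1, t2]] is the difference of two values of the continuous primitive of
     [h], so half of [eps] is allotted to each end. *)
  pose (e2 := pos_div_2 eps).
  destruct (proj1 (filterlim_locally _ _) (Hcont 0) e2) as [d1 Hd1].
  destruct (proj1 (filterlim_locally _ _) (Hcont (PI / 2)) e2) as [d2 Hd2].
  rewrite (RInt_point (V := R_CompleteNormedModule)) in Hd1.
  pose proof (cond_pos d1); pose proof (cond_pos d2).
  (* Thresholds in [t], cut off at [PI / 4] to stay inside the open quarter period. As [g] is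
     monotone, [x < g r1] forces [t1 < r1], and likewise at the other end. *)
  set (r1 := Rmin d1 (PI / 4)); set (r2 := Rmax (PI / 2 - d2) (PI / 4)).
  assert (Hr1 : 0 < r1 <= d1 /\ r1 < PI / 2)
    by (unfold r1; split; [split; [apply Rmin_case|apply Rmin_l]|
          apply Rle_lt_trans with (PI / 4); [apply Rmin_r|]]; lra).
  assert (Hr2 : 0 < r2 < PI / 2 /\ PI / 2 - d2 <= r2)
    by (unfold r2; split; [split; [apply Rlt_le_trans with (PI / 4); [lra|apply Rmax_r]|
          apply Rmax_case]|apply Rmax_l]; lra).
  pose proof (Hgin r1 ltac:(lra)) as Hgr1; pose proof (Hgin r2 ltac:(lra)) as Hgr2.
  apply Filter_prod with (fun x => p < x < g r1) (fun y => g r2 < y < q).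
  - exists (mkposreal (g r1 - p) ltac:(lra)); intros x Hx Hpx.
    apply Rabs_lt_between' in Hx; simpl in Hx; lra.
  - exists (mkposreal (q - g r2) ltac:(lra)); intros x Hx Hpx.
    apply Rabs_lt_between' in Hx; simpl in Hx; lra.
  - intros x y Hx Hy; simpl.
    destruct (Hinv x ltac:(lra)) as [t1 [Ht1 <-]].
    destruct (Hinv y ltac:(lra)) as [t2 [Ht2 <-]].
    exists (RInt h t1 t2); split; [now apply Hsub|].
    assert (t1 < r1)
      by (apply Rnot_le_lt; intros Hle; generalize (Hmono r1 t1 ltac:(lra) Hle ltac:(lra)); lra).
    assert (r2 < t2)
      by (apply Rnot_le_lt; intros Hle; generalize (Hmono t2 r2 ltac:(lra) Hle ltac:(lra)); lra).
    specialize (Hd1 t1 ltac:(apply Rabs_lt_between'; lra)).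
    specialize (Hd2 t2 ltac:(apply Rabs_lt_between'; lra)).
    apply Rabs_lt_between' in Hd1; apply Rabs_lt_between' in Hd2.
    unfold zero in Hd1; simpl in Hd1, Hd2.
    pose proof (RInt_Chasles (V := R_CompleteNormedModule) h 0 t1 t2 (Hexh _ _) (Hexh _ _)) as HC.
    unfold plus in HC; simpl in HC.
    apply HP, Rabs_lt_between'; simpl in *; lra.
Qed.

Lemma aper_eq nu u1 u2 u3 : - nu < u1 -> u1 < u2 -> u2 < u3 ->
  aper nu u1 u2 u3 = 4 * period_integral (u1 + nu) (u2 + nu) (u3 + nu).
Proof.
  intros H1 H2 H3; unfold aper.
  assert (Hgen : is_RInt_gen (fun l => (l + nu) / sqrt (Rpol nu u1 u2 u3 l))
            (at_right u1) (at_left u2)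
            (RInt (fun t => scal 2 (period_integrand (u1 + nu) (u2 + nu) (u3 + nu) t))
               0 (PI / 2))).
  { apply is_RInt_gen_trig_subst; [lra| | |].
    - intros l Hl; apply (ex_derive_continuous (V := R_NormedModule)).
      assert (0 < Rpol nu u1 u2 u3 l).
      { unfold Rpol.
        replace ((l + nu) * (l - u1) * (l - u2) * (l - u3))
          with ((l + nu) * (l - u1) * ((u2 - l) * (u3 - l))) by ring.
        repeat apply Rmult_lt_0_compat; lra. }
      assert (0 < sqrt (Rpol nu u1 u2 u3 l)) by now apply sqrt_lt_R0.
      unfold Rpol in *; auto_derive; split; [|split]; unfold Rminus in *; lra.
    - intros t; apply (ex_derive_continuous (V := R_NormedModule)).
      apply (ex_derive_scal (period_integrand _ _ _)); apply ex_derive_period_integrand; lra.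
    - intros t Ht; unfold period_integrand, scal; simpl; unfold mult; simpl.
      replace (sin t * (sin t * 1)) with (sin t ^ 2) by ring.
      replace (u2 + nu - (u1 + nu)) with (u2 - u1) by ring.
      pose proof (segment_range u1 u2 _ H2 (sin_sq_bounds t)) as Hx.
      set (l := u1 + (u2 - u1) * sin t ^ 2) in *.
      replace (u1 + nu + (u2 - u1) * sin t ^ 2) with (l + nu) by (unfold l; ring).
      assert (Hs : 0 < sin t) by (apply sin_gt_0; lra).
      assert (Hc : 0 < cos t) by (apply cos_gt_0; lra).
      (* The two factors vanishing at [u1] and [u2] combine into a perfect square whose root cancels
         the Jacobian up to the factor 2. *)
      replace (Rpol nu u1 u2 u3 l) with
        ((l + nu) * (u3 - l) * ((u2 - u1) * sin t * cos t) ^ 2).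
      2: { unfold Rpol.
           replace (l - u1) with ((u2 - u1) * sin t ^ 2) by (unfold l; ring).
           replace (l - u2) with (- (u2 - u1) * cos t ^ 2) by (rewrite cos_sq; unfold l; ring).
           ring. }
      assert (0 < (u2 - u1) * sin t * cos t)
        by (repeat apply Rmult_lt_0_compat; lra).
      rewrite sqrt_mult_alt by (apply Rmult_le_pos; lra).
      rewrite sqrt_pow2, sqrt_mult_alt, sqrt_div_alt by lra.
      replace (u3 + nu - (l + nu)) with (u3 - l) by ring.
      assert (0 < sqrt (u3 - l)) by (apply sqrt_lt_R0; lra).
      assert (0 < sqrt (l + nu)) by (apply sqrt_lt_R0; lra).
      rewrite <- (sqrt_sqrt (l + nu)) at 1 by lra.
      field; repeat split; lra. }
  rewrite (is_RInt_gen_unique (V := R_CompleteNormedModule) _ _ Hgen).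
  rewrite (RInt_scal (V := R_CompleteNormedModule)) by (apply ex_RInt_period; lra).
  unfold period_integral, scal; simpl; unfold mult; simpl; ring.
Qed.

Lemma period_integral_pos a b c : 0 < a -> a < b -> b < c -> 0 < period_integral a b c.
Proof.
  intros Ha Hb Hc; unfold period_integral.
  apply RInt_gt_0; [apply half_PI_pos| |].
  - intros t _; apply sqrt_lt_R0.
    pose proof (segment_range a b _ Hb (sin_sq_bounds t)); apply Rdiv_lt_0_compat; lra.
  - intros t _; apply (ex_derive_continuous (V := R_NormedModule)).
    now apply ex_derive_period_integrand.
Qed.

(** * Differentiation of the period in the branch points *)

Lemma locally_affine_pos k0 k1 x : 0 < k0 + k1 * x -> locally x (fun y => 0 < k0 + k1 * y).
Proof.
  intros H; apply (open_gt 0) in H; revert H.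
  apply (continuous_comp (fun y => k0 + k1 * y) (fun y => y)); [|apply continuous_id].
  apply (ex_derive_continuous (V := R_NormedModule)); auto_derive; trivial.
Qed.

Ltac continuity_2d :=
  repeat first
    [ apply continuity_2d_pt_plus | apply continuity_2d_pt_opp | apply continuity_2d_pt_mult
    | apply continuity_2d_pt_inv | apply continuity_2d_pt_const | apply continuity_2d_pt_id1
    | apply (continuity_1d_2d_pt_comp sin); [apply continuity_sin | apply continuity_2d_pt_id2]
    | apply (continuity_1d_2d_pt_comp sqrt); [apply continuity_pt_sqrt | ] ].

(* A single formula for the three partial derivatives: each is the derivative along an affine
   curve in the parameter space, with velocity [(a1, b1, c1)] a unit vector. *)
Lemma is_derive_period_integral a0 a1 b0 b1 c0 c1 x :
  let a := a0 + a1 * x in let b := b0 + b1 * x in let c := c0 + c1 * x in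
  0 < a -> a < b -> b < c ->
  is_derive (fun y => period_integral (a0 + a1 * y) (b0 + b1 * y) (c0 + c1 * y)) x
    (RInt (fun t => ((a1 + (b1 - a1) * sin t ^ 2) * c - (a + (b - a) * sin t ^ 2) * c1)
       / (2 * period_integrand a b c t * (c - (a + (b - a) * sin t ^ 2)) ^ 2)) 0 (PI / 2)).
Proof.
  intros a b c Ha Hb Hc.
  (* The parameters for which the branch points on the curve remain positive and ordered; this
     persists near [x]. *)
  set (dom := fun y => 0 < a0 + a1 * y /\ 0 < (b0 - a0) + (b1 - a1) * y /\
                       0 < (c0 - b0) + (c1 - b1) * y).
  assert (Hdom : locally x dom).
  { repeat apply filter_and; apply locally_affine_pos; unfold a, b, c in *; lra. }
  assert (HX : forall y t, dom y ->
     0 < a0 + a1 * y + (b0 + b1 * y - (a0 + a1 * y)) * sin t ^ 2 < c0 + c1 * y).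
  { intros y t [Hy1 [Hy2 Hy3]].
    generalize (segment_range (a0 + a1 * y) (b0 + b1 * y) _ ltac:(lra) (sin_sq_bounds t)); lra. }
  set (df := fun y t =>
     ((a1 + (b1 - a1) * sin t ^ 2) * (c0 + c1 * y)
      - (a0 + a1 * y + (b0 + b1 * y - (a0 + a1 * y)) * sin t ^ 2) * c1)
     / (2 * period_integrand (a0 + a1 * y) (b0 + b1 * y) (c0 + c1 * y) t *
        (c0 + c1 * y - (a0 + a1 * y + (b0 + b1 * y - (a0 + a1 * y)) * sin t ^ 2)) ^ 2)).
  assert (Hder : forall y t, dom y -> is_derive
     (fun z => period_integrand (a0 + a1 * z) (b0 + b1 * z) (c0 + c1 * z) t) y (df y t)).
  { intros y t Hy; pose proof (HX y t Hy) as Hyt; unfold df, period_integrand.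
    set (X := a0 + a1 * y + (b0 + b1 * y - (a0 + a1 * y)) * sin t ^ 2) in *.
    set (C := c0 + c1 * y) in *.
    assert (HF : 0 < X / (C - X)) by (apply Rdiv_lt_0_compat; lra).
    assert (Hq : 0 < sqrt (X / (C - X))) by now apply sqrt_lt_R0.
    evar_last.
    - apply (is_derive_sqrt (fun z => (a0 + a1 * z + (b0 + b1 * z - (a0 + a1 * z)) * sin t ^ 2) /
         (c0 + c1 * z - (a0 + a1 * z + (b0 + b1 * z - (a0 + a1 * z)) * sin t ^ 2)))).
      + apply (is_derive_div (fun z => a0 + a1 * z + (b0 + b1 * z - (a0 + a1 * z)) * sin t ^ 2)
           (fun z => c0 + c1 * z - (a0 + a1 * z + (b0 + b1 * z - (a0 + a1 * z)) * sin t ^ 2))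
           y (a1 + (b1 - a1) * sin t ^ 2) (c1 - (a1 + (b1 - a1) * sin t ^ 2))).
        * auto_derive; [trivial|ring].
        * auto_derive; [trivial|ring].
        * fold X C; lra.
      + exact HF.
    - fold X C. field; lra. }
  apply (is_derive_ext_loc (fun y => RInt (fun t =>
     period_integrand (a0 + a1 * y) (b0 + b1 * y) (c0 + c1 * y) t) 0 (PI / 2))).
  { apply filter_forall; intros y; reflexivity. }
  assert (Hdx : dom x) by (apply locally_singleton, Hdom).
  evar_last.
  - apply (is_derive_RInt_param (fun y t =>
       period_integrand (a0 + a1 * y) (b0 + b1 * y) (c0 + c1 * y) t)).
    + revert Hdom; apply filter_imp; intros y Hy t _; eexists; now apply Hder.
    + intros t _.
      (* Joint continuity is checked on the explicit formula [df], which agrees with the [Derive]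
         term for all parameters near [x]. *)
      apply (continuity_2d_pt_ext_loc df).
      * destruct Hdom as [e He]; exists e; intros u v Hu _.
        symmetry; apply is_derive_unique, Hder, He, Hu.
      * pose proof (HX x t Hdx) as Hxt.
        assert (HF : 0 < (a0 + a1 * x + (b0 + b1 * x - (a0 + a1 * x)) * sin t ^ 2) /
         (c0 + c1 * x - (a0 + a1 * x + (b0 + b1 * x - (a0 + a1 * x)) * sin t ^ 2)))
          by (apply Rdiv_lt_0_compat; lra).
        pose proof (sqrt_lt_R0 _ HF) as Hq.
        unfold df, period_integrand, Rdiv, pow in *.
        continuity_2d; try lra.
        apply Rgt_not_eq; repeat apply Rmult_lt_0_compat; lra.
    + revert Hdom; apply filter_imp; intros y [Hy1 [Hy2 Hy3]]; apply ex_RInt_period; lra.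
  - apply RInt_ext; intros t _; apply is_derive_unique, Hder, Hdx.
Qed.

(** * Reduction of the period and its derivatives to Legendre form *)

Lemma RInt_sin_sq_modulus_cubed m : 0 < m < 1 ->
  is_RInt (fun t => sin t ^ 2 / ((1 - m * sin t ^ 2) * sqrt (1 - m * sin t ^ 2))) 0 (PI / 2)
    (ellB m / (1 - m)).
Proof.
  intros Hm; assert (Hm' : 0 <= m < 1) by lra.
  (* With [y = 1 - m * sin t ^ 2], the numerator [sin t ^ 2] is [(1 - y) / m]; the division is why
     [m] must be positive here. *)
  apply is_RInt_ext with (fun t => scal (/ m)
    (minus (/ ((1 - m * sin t ^ 2) * sqrt (1 - m * sin t ^ 2))) (/ sqrt (1 - m * sin t ^ 2)))).
  - intros t _; generalize (modulus_sqrt_pos m t Hm') (modulus_factor_pos m t Hm'); intros.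
    unfold scal, minus, plus, opp; simpl; unfold mult; simpl; simpl in *; field; lra.
  - replace (ellB m / (1 - m)) with (scal (/ m) (minus (ellE m / (1 - m)) (ellK m))).
    2: { rewrite ellK_eq, ellE_eq by exact Hm'.
         unfold scal, minus, plus, opp; simpl; unfold mult; simpl; field; lra. }
    apply (is_RInt_scal (V := R_NormedModule)), (is_RInt_minus (V := R_NormedModule)).
    + apply RInt_modulus_cubed, Hm'.
    + apply (RInt_correct (V := R_CompleteNormedModule)), ex_RInt_ellK, Hm'.
Qed.

(** [modulus_sq] and [charac] are [s ^ 2] and [rho ^ 2] in the shifted branch points [a], [b], [c].
    Working with the squares keeps the algebra rational. *)
Definition modulus_sq (a b c : R) : R := c * (b - a) / (b * (c - a)).
Definition charac (a b : R) : R := (b - a) / b.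

Lemma charac_range a b : 0 < a -> a < b -> 0 < charac a b < 1.
Proof.
  intros Ha Hb; unfold charac; split; [apply Rdiv_lt_0_compat; lra|].
  apply Rlt_div_l; lra.
Qed.

Lemma compl_modulus_sq a b c : 0 < a -> a < b -> b < c ->
  1 - modulus_sq a b c = a * (c - b) / (b * (c - a)).
Proof. intros; unfold modulus_sq; field; lra. Qed.

Lemma modulus_sq_range a b c : 0 < a -> a < b -> b < c -> 0 < modulus_sq a b c < 1.
Proof.
  intros Ha Hb Hc; split.
  - apply Rdiv_lt_0_compat; apply Rmult_lt_0_compat; lra.
  - enough (0 < 1 - modulus_sq a b c) by lra.
    rewrite compl_modulus_sq by lra.
    apply Rdiv_lt_0_compat; apply Rmult_lt_0_compat; lra.
Qed.

(* The substitution [x = a / (1 - n sin^2 t)] with [n = charac a b]. *)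
Lemma RInt_moebius_subst (g : R -> R) a b : 0 < a -> a < b ->
  (forall x, a <= x <= b -> continuous g x) ->
  RInt (fun t => g (a + (b - a) * sin t ^ 2)) 0 (PI / 2) =
  RInt (fun t => sqrt (a / b) / (1 - charac a b * sin t ^ 2) * g (a / (1 - charac a b * sin t ^ 2)))
    0 (PI / 2).
Proof.
  intros Ha Hb Hg.
  pose proof (charac_range a b Ha Hb) as Hn.
  assert (Hab : 0 < a / b) by (apply Rdiv_lt_0_compat; lra).
  (* For the scale [sqrt (a / b)] the denominator [cos t ^ 2 + a / b * sin t ^ 2] is exactly
     [1 - charac a b * sin t ^ 2]. *)
  rewrite (RInt_tan_scaling (fun x => g (a + (b - a) * x)) (sqrt (a / b))).
  - apply RInt_ext; intros t _.
    pose proof (modulus_factor_pos (charac a b) t ltac:(lra)) as HD.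
    rewrite pow2_sqrt by lra.
    replace (cos t ^ 2 + a / b * sin t ^ 2) with (1 - charac a b * sin t ^ 2)
      by (rewrite cos_sq; unfold charac; field; lra).
    f_equal; f_equal.
    set (d := 1 - charac a b * sin t ^ 2) in *.
    assert (Hd : d = 1 - (b - a) / b * sin t ^ 2) by reflexivity; clearbody d.
    field_simplify_eq; [|lra]; rewrite Hd; field; lra.
  - apply sqrt_lt_R0, Hab.
  - intros x Hx; apply (continuous_comp (fun x => a + (b - a) * x) g).
    + apply (ex_derive_continuous (V := R_NormedModule)); auto_derive; trivial.
    + apply Hg, segment_range; lra.
Qed.

(** Here the modulus arises: over the common denominator the numerator is
    [c - a - c * charac a b * sin t ^ 2], and [c * charac a b / (c - a)] is [modulus_sq a b c]. *)
Lemma moebius_gap a b c t : 0 < a -> a < b -> b < c ->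
  c - a / (1 - charac a b * sin t ^ 2) =
  (c - a) * (1 - modulus_sq a b c * sin t ^ 2) / (1 - charac a b * sin t ^ 2).
Proof.
  intros Ha Hb Hc.
  pose proof (modulus_factor_pos (charac a b) t ltac:(generalize (charac_range a b Ha Hb); lra)) as HD.
  apply Rmult_eq_reg_r with (1 - charac a b * sin t ^ 2); [|lra].
  field_simplify; [|lra|lra]. unfold charac, modulus_sq; field; lra.
Qed.

Lemma moebius_ratio_sqrt a b c t : 0 < a -> a < b -> b < c ->
  sqrt (a / (1 - charac a b * sin t ^ 2) / (c - a / (1 - charac a b * sin t ^ 2))) =
  sqrt (a / (c - a)) / sqrt (1 - modulus_sq a b c * sin t ^ 2).
Proof.
  intros Ha Hb Hc.
  pose proof (modulus_factor_pos (charac a b) t ltac:(generalize (charac_range a b Ha Hb); lra)) as HD.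
  pose proof (modulus_factor_pos (modulus_sq a b c) t
    ltac:(generalize (modulus_sq_range a b c Ha Hb Hc); lra)) as HY.
  rewrite moebius_gap, <- sqrt_div_alt by lra.
  f_equal; field; lra.
Qed.

Lemma sqrt_prefactor a b c : 0 < a -> a < b -> b < c ->
  sqrt (a / b) * sqrt (a / (c - a)) = a / sqrt (b * (c - a)).
Proof.
  intros Ha Hb Hc.
  rewrite !sqrt_div_alt, sqrt_mult_alt by lra.
  assert (0 < sqrt b) by (apply sqrt_lt_R0; lra).
  assert (0 < sqrt (c - a)) by (apply sqrt_lt_R0; lra).
  transitivity (sqrt a * sqrt a / (sqrt b * sqrt (c - a))); [field; lra|].
  rewrite sqrt_sqrt by lra; reflexivity.
Qed.

Lemma period_integral_eq a b c : 0 < a -> a < b -> b < c ->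
  period_integral a b c = a / sqrt (b * (c - a)) * ellPi (charac a b) (modulus_sq a b c).
Proof.
  intros Ha Hb Hc.
  pose proof (charac_range a b Ha Hb) as Hn; pose proof (modulus_sq_range a b c Ha Hb Hc) as Hm.
  unfold period_integral, period_integrand.
  rewrite (RInt_moebius_subst (fun x => sqrt (x / (c - x)))) by
    (try lra; intros x Hx;
     assert (0 < x / (c - x)) by (apply Rdiv_lt_0_compat; lra);
     apply (ex_derive_continuous (V := R_NormedModule));
     auto_derive; unfold Rdiv, Rminus in *; split; lra).
  rewrite <- (sqrt_prefactor a b c) by lra; unfold ellPi.
  transitivity (RInt (fun t => scal (sqrt (a / b) * sqrt (a / (c - a)))
     (/ ((1 - charac a b * sin t ^ 2) * sqrt (1 - modulus_sq a b c * sin t ^ 2)))) 0 (PI / 2)).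
  - apply RInt_ext; intros t _; rewrite moebius_ratio_sqrt by lra.
    generalize (modulus_factor_pos (charac a b) t ltac:(lra))
      (modulus_sqrt_pos (modulus_sq a b c) t ltac:(lra)); intros.
    unfold scal; simpl; unfold mult; simpl; simpl in *; field; lra.
  - apply (RInt_scal (V := R_CompleteNormedModule)), ex_RInt_ellPi; lra.
Qed.

(** After the substitution the integrand is a combination of [1] and [sin t ^ 2] over the cube of
    the modulus root, and these integrate to [ellE m / (1 - m)] and [ellB m / (1 - m)]. The [a1]
    part carries their difference, which is [ellD m] by [ellE_eq]; so only the other two parts keep
    the factor [1 - m] in the denominator. *)
Lemma period_derivative_value a b c a1 b1 c1 : 0 < a -> a < b -> b < c ->
  RInt (fun t => ((a1 + (b1 - a1) * sin t ^ 2) * c - (a + (b - a) * sin t ^ 2) * c1)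
       / (2 * period_integrand a b c t * (c - (a + (b - a) * sin t ^ 2)) ^ 2)) 0 (PI / 2) =
  (c * a1 * ellD (modulus_sq a b c) +
   (c * b1 * (a / b) * ellB (modulus_sq a b c) - a * c1 * ellE (modulus_sq a b c)) / (1 - modulus_sq a b c))
  / (2 * sqrt (b * (c - a)) * (c - a)).
Proof.
  intros Ha Hb Hc.
  pose proof (charac_range a b Ha Hb) as Hn; pose proof (modulus_sq_range a b c Ha Hb Hc) as Hm.
  set (n := charac a b) in *; set (m := modulus_sq a b c) in *.
  assert (Hca : 0 < sqrt (a / (c - a))) by (apply sqrt_lt_R0, Rdiv_lt_0_compat; lra).
  (* [sin t ^ 2] is rewritten as [(x - a) / (b - a)], since the substitution lemma needs an
     integrand that depends on [x] alone. *)
  set (g := fun x => ((a1 + (b1 - a1) * ((x - a) / (b - a))) * c - x * c1)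
       / (2 * sqrt (x / (c - x)) * (c - x) ^ 2)).
  transitivity (RInt (fun t => g (a + (b - a) * sin t ^ 2)) 0 (PI / 2)).
  { apply RInt_ext; intros t _; unfold g, period_integrand.
    replace ((a + (b - a) * sin t ^ 2 - a) / (b - a)) with (sin t ^ 2) by (field; lra).
    reflexivity. }
  rewrite RInt_moebius_subst.
  2, 3: lra.
  2: { intros x Hx; assert (HF : 0 < x / (c - x)) by (apply Rdiv_lt_0_compat; lra).
       pose proof (sqrt_lt_R0 _ HF).
       apply (ex_derive_continuous (V := R_NormedModule)); unfold g.
       auto_derive; unfold Rdiv, Rminus in *; simpl in *.
       repeat split; try lra.
       apply Rgt_not_eq; repeat apply Rmult_lt_0_compat; lra. }
  fold n.
  set (w := / (2 * sqrt (b * (c - a)) * (c - a))).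
  set (P := c * a1 - a * c1); set (Q := c * (b1 * (a / b) - a1)).
  apply is_RInt_unique.
  apply is_RInt_ext with (fun t => scal w (plus
     (scal P (/ ((1 - m * sin t ^ 2) * sqrt (1 - m * sin t ^ 2))))
     (scal Q (sin t ^ 2 / ((1 - m * sin t ^ 2) * sqrt (1 - m * sin t ^ 2)))))).
  - intros t _; unfold g.
    unfold n; rewrite moebius_ratio_sqrt, moebius_gap by lra; fold n m.
    pose proof (modulus_factor_pos n t ltac:(lra)) as HD.
    pose proof (modulus_factor_pos m t ltac:(lra)) as HY.
    pose proof (modulus_sqrt_pos m t ltac:(lra)) as HQ.
    pose proof (modulus_sqrt_sq m t ltac:(lra)) as HS.
    unfold scal, plus; simpl; unfold mult; simpl.
    replace (sin t * (sin t * 1)) with (sin t ^ 2) by ring.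
    assert (Hsig : (a / (1 - n * sin t ^ 2) - a) / (b - a) =
                   a / b * sin t ^ 2 / (1 - n * sin t ^ 2)).
    { set (d := 1 - n * sin t ^ 2) in *.
      assert (Hd : d = 1 - (b - a) / b * sin t ^ 2) by reflexivity; clearbody d.
      field_simplify_eq; [|lra]; rewrite Hd; field; lra. }
    rewrite Hsig.
    replace w with (sqrt (a / b) / (2 * sqrt (a / (c - a)) * (c - a) ^ 2)).
    2: {
      unfold w.
      rewrite !sqrt_div_alt, sqrt_mult_alt by lra.
      assert (0 < sqrt b) by (apply sqrt_lt_R0; lra).
      assert (0 < sqrt a) by (apply sqrt_lt_R0; lra).
      assert (0 < sqrt (c - a)) by (apply sqrt_lt_R0; lra).
      pose proof (sqrt_sqrt (c - a) ltac:(lra)) as Hr.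
      set (r := sqrt (c - a)) in *; clearbody r; rewrite <- Hr; field; lra. }
    set (q := sqrt (1 - m * sin t ^ 2)) in *; rewrite <- HS in *.
    replace ((a1 + (b1 - a1) * (a / b * sin t ^ 2 / (1 - n * sin t ^ 2))) * c -
              a / (1 - n * sin t ^ 2) * c1)
      with ((P + Q * sin t ^ 2) / (1 - n * sin t ^ 2))
      by (unfold P, Q; set (d := 1 - n * sin t ^ 2) in *;
          assert (Hd : d = 1 - (b - a) / b * sin t ^ 2) by reflexivity; clearbody d;
          field_simplify_eq; [|lra]; rewrite Hd; field; lra).
    field; lra.
  - match goal with |- is_RInt _ _ _ ?r =>
      replace r with (scal w (plus (scal P (ellE m / (1 - m))) (scal Q (ellB m / (1 - m))))) end.
    + apply (is_RInt_scal (V := R_NormedModule)), (is_RInt_plus (V := R_NormedModule));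
        apply (is_RInt_scal (V := R_NormedModule)).
      * apply RInt_modulus_cubed; lra.
      * apply RInt_sin_sq_modulus_cubed; lra.
    + assert (0 < sqrt (b * (c - a))) by (apply sqrt_lt_R0, Rmult_lt_0_compat; lra).
      rewrite ellE_eq by lra; unfold scal, plus; simpl; unfold mult; simpl.
      unfold w, P, Q; field; lra.
Qed.

(** * Characteristic speeds in closed form *)

(** As [K] is a constant over [I], [K / K' = - I / I'], and the product rule gives
    [O' / K' = sigma + x + K / K']. The relation between [K] and [I] is required only near [x],
    because the period formula needs ordered branch points. *)
Lemma speed_of_period (I K O : R -> R) (sigma x dI : R) :
  is_derive I x dI -> 0 < I x -> dI <> 0 ->
  locally x (fun y => K y = 2 * PI / (4 * I y)) ->
  (forall y, O y = (sigma + y) * K y) ->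
  ex_derive K x /\ ex_derive O x /\ Derive K x <> 0 /\
  Derive O x / Derive K x = sigma + x - I x / dI.
Proof.
  intros HI HI0 HdI HK HO.
  pose proof PI_RGT_0 as Hpi.
  assert (Hk : is_derive K x (- (PI / 2) * dI / (I x) ^ 2)).
  { apply (is_derive_ext_loc (fun y => 2 * PI / (4 * I y))).
    - revert HK; apply filter_imp; intros y Hy; now rewrite Hy.
    - assert (ex_derive I x) by (exists dI; exact HI).
      auto_derive; [split; [assumption|split; [lra|trivial]]|].
      replace (Derive (fun x : R => I x) x) with dI by (symmetry; apply is_derive_unique, HI).
      field; lra. }
  assert (Hkv : K x = 2 * PI / (4 * I x)) by (apply locally_singleton in HK; exact HK).
  assert (Hk0 : - (PI / 2) * dI / (I x) ^ 2 <> 0).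
  { unfold Rdiv; repeat apply Rmult_integral_contrapositive_currified; try lra.
    apply Rinv_neq_0_compat, pow_nonzero; lra. }
  assert (Ho : is_derive O x (K x + (sigma + x) * (- (PI / 2) * dI / (I x) ^ 2))).
  { apply (is_derive_ext (fun y => (sigma + y) * K y)); [intros y; now rewrite HO|].
    assert (ex_derive K x) by (eexists; exact Hk).
    auto_derive; [tauto|].
    replace (Derive (fun x : R => K x) x) with (- (PI / 2) * dI / (I x) ^ 2)
      by (symmetry; apply is_derive_unique, Hk).
    ring. }
  repeat split.
  - eexists; exact Hk.
  - eexists; exact Ho.
  - now rewrite (is_derive_unique _ _ _ Hk).
  - rewrite (is_derive_unique _ _ _ Hk), (is_derive_unique _ _ _ Ho), Hkv.
    field; lra.
Qed.

Lemma smod_sq nu u1 u2 u3 : - nu < u1 -> u1 < u2 -> u2 < u3 ->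
  smod nu u1 u2 u3 ^ 2 = modulus_sq (u1 + nu) (u2 + nu) (u3 + nu).
Proof.
  intros; pose proof (modulus_sq_range (u1 + nu) (u2 + nu) (u3 + nu) ltac:(lra) ltac:(lra) ltac:(lra)).
  unfold smod.
  replace ((u2 - u1) * (u3 + nu) / ((u3 - u1) * (u2 + nu)))
    with (modulus_sq (u1 + nu) (u2 + nu) (u3 + nu)) by (unfold modulus_sq; field; lra).
  apply pow2_sqrt; lra.
Qed.

Lemma rhop_sq nu u1 u2 : - nu < u1 -> u1 < u2 -> rhop nu u1 u2 ^ 2 = charac (u1 + nu) (u2 + nu).
Proof.
  intros; pose proof (charac_range (u1 + nu) (u2 + nu) ltac:(lra) ltac:(lra)).
  unfold rhop.
  replace ((u2 - u1) / (u2 + nu))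
    with (charac (u1 + nu) (u2 + nu)) by (unfold charac; field; lra).
  apply pow2_sqrt; lra.
Qed.

Lemma ell_pos m : 0 < m < 1 -> 0 < ellB m /\ 0 < ellD m /\ 0 < ellE m /\ 0 < ellK m.
Proof.
  intros Hm; pose proof PI_RGT_0.
  pose proof (ellB_bounds m ltac:(lra)); pose proof (ellD_bounds m ltac:(lra)).
  rewrite ellE_eq, ellK_eq by lra.
  assert (0 < (1 - m) * ellD m) by (apply Rmult_lt_0_compat; lra).
  repeat split; lra.
Qed.

Lemma ellPi_pos n m : 0 < n < 1 -> 0 < m < 1 -> 0 < ellPi n m.
Proof.
  intros Hn Hm; pose proof (ell_pos m Hm); pose proof (ellPi_bounds n m ltac:(lra) ltac:(lra)).
  lra.
Qed.

(** [v] is the bracket in the derivative of the period. The period and its derivative share the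
    factor [/ sqrt (b * (c - a))], so their quotient is free of roots. [sigma] collects the summands
    of the phase velocity other than the varying invariant. *)
Lemma speed_along_curve a0 a1 b0 b1 c0 c1 x (K O : R -> R) sigma v :
  let a := a0 + a1 * x in let b := b0 + b1 * x in let c := c0 + c1 * x in
  let m := modulus_sq a b c in
  0 < a -> a < b -> b < c ->
  c * a1 * ellD m + (c * b1 * (a / b) * ellB m - a * c1 * ellE m) / (1 - m) = v ->
  v <> 0 ->
  locally x (fun y => K y =
    2 * PI / (4 * period_integral (a0 + a1 * y) (b0 + b1 * y) (c0 + c1 * y))) ->
  (forall y, O y = (sigma + y) * K y) ->
  (ex_derive K x /\ ex_derive O x /\ Derive K x <> 0) /\
  Derive O x / Derive K x = sigma + x - 2 * a * (c - a) * ellPi (charac a b) m / v.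
Proof.
  intros a b c m Ha Hb Hc Hv Hv0 HK HO.
  assert (HW : 0 < sqrt (b * (c - a))) by (apply sqrt_lt_R0, Rmult_lt_0_compat; lra).
  pose proof (is_derive_period_integral a0 a1 b0 b1 c0 c1 x Ha Hb Hc) as Hder.
  fold a b c in Hder; rewrite period_derivative_value in Hder by assumption.
  fold m in Hder; rewrite Hv in Hder.
  destruct (speed_of_period _ K O sigma x _ Hder) as [E1 [E2 [E3 E4]]].
  - now apply period_integral_pos.
  - unfold Rdiv; apply Rmult_integral_contrapositive_currified; [exact Hv0|].
    apply Rinv_neq_0_compat, Rgt_not_eq; repeat apply Rmult_lt_0_compat; lra.
  - exact HK.
  - exact HO.
  - repeat split; trivial.
    rewrite E4; fold a b c; rewrite period_integral_eq by assumption; fold m.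
    field; lra.
Qed.

Lemma locally_between p q x : p < x < q -> locally x (fun y => p < y < q).
Proof.
  intros H; exists (mkposreal (Rmin (x - p) (q - x)) ltac:(apply Rmin_case; lra)).
  intros y Hy; apply Rabs_lt_between' in Hy; simpl in Hy.
  pose proof (Rmin_l (x - p) (q - x)); pose proof (Rmin_r (x - p) (q - x)); lra.
Qed.

Lemma Cspeed1_closed nu u1 u2 u3 : - nu < u1 -> u1 < u2 -> u2 < u3 ->
  let a := u1 + nu in let b := u2 + nu in let c := u3 + nu in
  (ex_derive (fun x => kwave nu x u2 u3) u1 /\ ex_derive (fun x => omega nu x u2 u3) u1 /\
   Derive (fun x => kwave nu x u2 u3) u1 <> 0) /\
  Cspeed1 nu u1 u2 u3 = u1 + u2 + u3 + 2 * nu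
    - 2 * a * (c - a) * ellPi (charac a b) (modulus_sq a b c) / (c * ellD (modulus_sq a b c)).
Proof.
  intros H1 H2 H3 a b c.
  assert (Ha : 0 < a) by (unfold a; lra); assert (Hb : a < b) by (unfold a, b; lra);
    assert (Hc : b < c) by (unfold b, c; lra).
  pose proof (modulus_sq_range a b c Ha Hb Hc) as Hm.
  destruct (ell_pos _ Hm) as [HB [HD [HE HK]]].
  pose proof (speed_along_curve nu 1 b 0 c 0 u1 (fun x => kwave nu x u2 u3)
    (fun x => omega nu x u2 u3) (2 * nu + u2 + u3) (c * ellD (modulus_sq a b c))) as H; cbv zeta in H.
  replace (nu + 1 * u1) with a in H by (unfold a; ring).
  replace (b + 0 * u1) with b in H by ring; replace (c + 0 * u1) with c in H by ring.
  destruct H as [E1 E2]; trivial.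
  - field; lra.
  - apply Rgt_not_eq, Rmult_lt_0_compat; lra.
  - apply (filter_imp (fun y => - nu < y < u2)); [|apply locally_between; lra].
    intros y Hy; unfold kwave; rewrite aper_eq by lra; do 3 f_equal; unfold b, c; ring.
  - intros y; unfold omega; ring.
  - split; [exact E1|]; unfold Cspeed1; rewrite E2; ring.
Qed.

Lemma Cspeed2_closed nu u1 u2 u3 : - nu < u1 -> u1 < u2 -> u2 < u3 ->
  let a := u1 + nu in let b := u2 + nu in let c := u3 + nu in
  (ex_derive (fun x => kwave nu u1 x u3) u2 /\ ex_derive (fun x => omega nu u1 x u3) u2 /\
   Derive (fun x => kwave nu u1 x u3) u2 <> 0) /\
  Cspeed2 nu u1 u2 u3 = u1 + u2 + u3 + 2 * nu
    - 2 * a * (c - b) * ellPi (charac a b) (modulus_sq a b c) / (c * ellB (modulus_sq a b c)).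
Proof.
  intros H1 H2 H3 a b c.
  assert (Ha : 0 < a) by (unfold a; lra); assert (Hb : a < b) by (unfold a, b; lra);
    assert (Hc : b < c) by (unfold b, c; lra).
  pose proof (modulus_sq_range a b c Ha Hb Hc) as Hm.
  destruct (ell_pos _ Hm) as [HB [HD [HE HK]]].
  (* The bracket is [c * (a / b) * ellB / (1 - m)], simplified with [compl_modulus_sq]. *)
  pose proof (speed_along_curve a 0 nu 1 c 0 u2 (fun x => kwave nu u1 x u3)
    (fun x => omega nu u1 x u3) (2 * nu + u1 + u3)
    (c * (c - a) * ellB (modulus_sq a b c) / (c - b))) as H; cbv zeta in H.
  replace (nu + 1 * u2) with b in H by (unfold b; ring).
  replace (a + 0 * u2) with a in H by ring; replace (c + 0 * u2) with c in H by ring.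
  destruct H as [E1 E2]; trivial.
  - rewrite compl_modulus_sq by assumption; field; lra.
  - apply Rgt_not_eq, Rdiv_lt_0_compat; [repeat apply Rmult_lt_0_compat|]; lra.
  - apply (filter_imp (fun y => u1 < y < u3)); [|apply locally_between; lra].
    intros y Hy; unfold kwave; rewrite aper_eq by lra; do 3 f_equal; unfold a, c; ring.
  - intros y; unfold omega; ring.
  - split; [exact E1|]; unfold Cspeed2; rewrite E2; field; lra.
Qed.

Lemma Cspeed3_closed nu u1 u2 u3 : - nu < u1 -> u1 < u2 -> u2 < u3 ->
  let a := u1 + nu in let b := u2 + nu in let c := u3 + nu in
  (ex_derive (fun x => kwave nu u1 u2 x) u3 /\ ex_derive (fun x => omega nu u1 u2 x) u3 /\
   Derive (fun x => kwave nu u1 u2 x) u3 <> 0) /\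
  Cspeed3 nu u1 u2 u3 = u1 + u2 + u3 + 2 * nu
    + 2 * a * (c - b) * ellPi (charac a b) (modulus_sq a b c) / (b * ellE (modulus_sq a b c)).
Proof.
  intros H1 H2 H3 a b c.
  assert (Ha : 0 < a) by (unfold a; lra); assert (Hb : a < b) by (unfold a, b; lra);
    assert (Hc : b < c) by (unfold b, c; lra).
  pose proof (modulus_sq_range a b c Ha Hb Hc) as Hm.
  destruct (ell_pos _ Hm) as [HB [HD [HE HK]]].
  (* The bracket [- a * ellE / (1 - m)] is negative, unlike the other two; this sign puts the third
     speed above the phase velocity. *)
  pose proof (speed_along_curve a 0 b 0 nu 1 u3 (fun x => kwave nu u1 u2 x)
    (fun x => omega nu u1 u2 x) (2 * nu + u1 + u2)
    (- (b * (c - a) * ellE (modulus_sq a b c) / (c - b)))) as H; cbv zeta in H.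
  replace (nu + 1 * u3) with c in H by (unfold c; ring).
  replace (a + 0 * u3) with a in H by ring; replace (b + 0 * u3) with b in H by ring.
  destruct H as [E1 E2]; trivial.
  - rewrite compl_modulus_sq by assumption; field; lra.
  - apply Ropp_neq_0_compat, Rgt_not_eq, Rdiv_lt_0_compat;
      [repeat apply Rmult_lt_0_compat|]; lra.
  (* Nothing bounds the third invariant from above; [u3 + 1] is an arbitrary cap. *)
  - apply (filter_imp (fun y => u2 < y < u3 + 1)); [|apply locally_between; lra].
    intros y Hy; unfold kwave; rewrite aper_eq by lra; do 3 f_equal; unfold a, b; ring.
  - split; [exact E1|]; unfold Cspeed3; rewrite E2; field; lra.
Qed.

(** * Calculus of limits along a filter *)

Definition tends {T : Type} (F : (T -> Prop) -> Prop) (f : T -> R) (l : R) : Prop :=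
  filterlim f F (locally l).

Lemma tends_const {T} F {FF : Filter F} (c : R) : tends F (fun _ : T => c) c.
Proof. apply filterlim_const. Qed.

Lemma tends_plus {T} F {FF : Filter F} (f g : T -> R) l k :
  tends F f l -> tends F g k -> tends F (fun x => f x + g x) (l + k).
Proof.
  intros Hf Hg; apply (filterlim_comp_2 _ _ Rplus Hf Hg (filterlim_plus (V := R_NormedModule) l k)).
Qed.

Lemma tends_mult {T} F {FF : Filter F} (f g : T -> R) l k :
  tends F f l -> tends F g k -> tends F (fun x => f x * g x) (l * k).
Proof.
  intros Hf Hg; apply (filterlim_comp_2 _ _ Rmult Hf Hg (filterlim_mult (K := R_AbsRing) l k)).
Qed.

Lemma tends_comp {T} (F : (T -> Prop) -> Prop) (h : R -> R) (f : T -> R) l :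
  continuous h l -> tends F f l -> tends F (fun x => h (f x)) (h l).
Proof. intros Hh Hf; exact (filterlim_comp _ _ _ f h F (locally l) (locally (h l)) Hf Hh). Qed.

Lemma tends_minus {T} F {FF : Filter F} (f g : T -> R) l k :
  tends F f l -> tends F g k -> tends F (fun x => f x - g x) (l - k).
Proof.
  intros Hf Hg; apply (tends_plus F); [exact Hf|].
  apply (tends_comp F Ropp); [|exact Hg].
  apply (ex_derive_continuous (V := R_NormedModule)); auto_derive; trivial.
Qed.

Lemma tends_inv {T} (F : (T -> Prop) -> Prop) (f : T -> R) l :
  l <> 0 -> tends F f l -> tends F (fun x => / f x) (/ l).
Proof.
  intros Hl; apply tends_comp.
  apply (ex_derive_continuous (V := R_NormedModule) Rinv); auto_derive; trivial.
Qed.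

Lemma tends_div {T} F {FF : Filter F} (f g : T -> R) l k :
  k <> 0 -> tends F f l -> tends F g k -> tends F (fun x => f x / g x) (l / k).
Proof. intros Hk Hf Hg; apply (tends_mult F); [exact Hf|]; now apply tends_inv. Qed.

Lemma tends_sqrt {T} (F : (T -> Prop) -> Prop) (f : T -> R) l :
  0 <= l -> tends F f l -> tends F (fun x => sqrt (f x)) (sqrt l).
Proof.
  intros Hl; apply tends_comp, continuity_pt_filterlim, continuity_pt_sqrt, Hl.
Qed.

Lemma tends_squeeze {T} F {FF : Filter F} (f g h : T -> R) l k :
  F (fun x => f x <= g x <= h x) -> tends F f l -> tends F h k -> l = k -> tends F g l.
Proof. intros H Hf Hh <-; exact (filterlim_le_le f g h l H Hf Hh). Qed.

Lemma tends_eq {T} (F : (T -> Prop) -> Prop) (f : T -> R) l k :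
  tends F f l -> l = k -> tends F f k.
Proof. now intros H <-. Qed.

(** Hypotheses are tried first, so limits already established for compound terms are used before the
    terms are taken apart. The limit is assembled in an existential variable; what remains are
    nonvanishing conditions and its equality with the claimed value. *)
Ltac tends_step :=
  first [ eassumption | apply tends_const | eapply tends_minus | eapply tends_plus
        | eapply tends_mult | eapply tends_div | eapply tends_inv | eapply tends_sqrt ].
Ltac tends_auto := eapply tends_eq; [repeat tends_step|].

(** * Limits as two Riemann invariants coalesce *)

Lemma tends_fst (D : R * R -> Prop) v w k :
  tends (within D (locally (v, w))) (fun p => fst p + k) (v + k).
Proof.
  apply (tends_plus _); [|apply (tends_const _)].
  apply (filterlim_filter_le_1 (F := locally (v, w)));
    [apply filter_le_within|apply (continuous_fst (U := R_UniformSpace) (V := R_UniformSpace))].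
Qed.

Lemma tends_snd (D : R * R -> Prop) v w k :
  tends (within D (locally (v, w))) (fun p => snd p + k) (w + k).
Proof.
  apply (tends_plus _); [|apply (tends_const _)].
  apply (filterlim_filter_le_1 (F := locally (v, w)));
    [apply filter_le_within|apply (continuous_snd (U := R_UniformSpace) (V := R_UniformSpace))].
Qed.

Lemma within_always {T} F {FF : Filter F} (D P : T -> Prop) :
  (forall x, D x -> P x) -> within D F P.
Proof. intros H; unfold within; apply filter_forall; exact H. Qed.

(** From [ellPi <= ellK / (1 - n)] and [ellK <= PI / 2 / sqrt (1 - m)] the product with [1 - m] is
    of order [sqrt (1 - m)]. [X] stands for [ellB] or [ellE], and the constant 2 is [PI / 2] over
    [PI / 4]. *)
Lemma soliton_estimate n m X : 0 < n < 1 -> 0 < m < 1 -> PI / 4 <= X ->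
  0 <= (1 - m) * ellPi n m / X <= 2 * / (1 - n) * sqrt (1 - m).
Proof.
  intros Hn Hm HX; pose proof PI_RGT_0 as Hpi.
  pose proof (ellPi_pos n m Hn Hm) as HP.
  destruct (ellPi_bounds n m ltac:(lra) ltac:(lra)) as [[_ HU] _].
  pose proof (ellK_le m ltac:(lra)) as HK.
  assert (HN : 0 < / (1 - n)) by (apply Rinv_0_lt_compat; lra).
  assert (He : 0 < sqrt (1 - m)) by (apply sqrt_lt_R0; lra).
  pose proof (sqrt_sqrt (1 - m) ltac:(lra)) as Hee.
  split.
  - apply Rmult_le_pos; [apply Rmult_le_pos; lra|apply Rlt_le, Rinv_0_lt_compat; lra].
  - apply Rle_div_l; [lra|].
    apply Rle_trans with (/ (1 - n) * (PI / 2) * sqrt (1 - m)).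
    + rewrite <- Hee at 1.
      apply Rle_trans with (sqrt (1 - m) * sqrt (1 - m) * (/ (1 - n) * (PI / 2 * / sqrt (1 - m)))).
      * apply Rmult_le_compat_l; [nra|].
        apply Rle_trans with (1 := HU); apply Rmult_le_compat_l; lra.
      * apply Req_le; field; lra.
    + assert (0 < / (1 - n) * sqrt (1 - m)) by (apply Rmult_lt_0_compat; lra). nra.
Qed.

Lemma ellD_blowup {T} F {FF : Filter F} (m : T -> R) :
  F (fun x => 0 < m x < 1) -> tends F (fun x => sqrt (1 - m x)) 0 ->
  tends F (fun x => / ellD (m x)) 0.
Proof.
  intros Hm He; apply filterlim_locally; intros eps.
  (* [ellD] is at least [- ln (sqrt (1 - m)) - 1], because [ellB <= 1]; this radius makes that bound
     exceed [/ eps]. *)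
  set (r := exp (- (/ eps + 1))).
  assert (Hr : 0 < r) by apply exp_pos.
  pose proof (proj1 (filterlim_locally _ _) He (mkposreal r Hr)) as Hb.
  generalize (filter_and _ _ Hm Hb); apply filter_imp; intros x [Hmx Hx].
  apply Rabs_lt_between' in Hx; simpl in Hx.
  assert (Hs : 0 < sqrt (1 - m x)) by (apply sqrt_lt_R0; lra).
  pose proof (ellK_ge_log (m x) ltac:(lra)) as HK.
  pose proof (ellB_bounds (m x) ltac:(lra)) as HB.
  rewrite ellK_eq in HK by lra.
  assert (Hln : ln (sqrt (1 - m x)) < - (/ eps + 1)).
  { rewrite <- (ln_exp (- (/ eps + 1))); apply ln_increasing; [exact Hs|]; fold r; lra. }
  assert (Hep : 0 < / eps) by (apply Rinv_0_lt_compat, eps).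
  assert (Hlt : / ellD (m x) < eps).
  { rewrite <- (Rinv_inv eps); apply Rinv_lt_contravar; [apply Rmult_lt_0_compat|]; lra. }
  assert (0 < / ellD (m x)) by (apply Rinv_0_lt_compat; lra).
  apply Rabs_lt_between'; lra.
Qed.

Lemma soliton_limit nu u1 v : - nu < u1 -> u1 < v ->
  let F := within (fun p : R * R => u1 < fst p /\ fst p < snd p) (locally (v, v)) in
  tends F (fun p => Cspeed1 nu u1 (fst p) (snd p)) (3 * u1 + 2 * nu) /\
  tends F (fun p => Cspeed2 nu u1 (fst p) (snd p)) (u1 + 2 * v + 2 * nu) /\
  tends F (fun p => Cspeed3 nu u1 (fst p) (snd p)) (u1 + 2 * v + 2 * nu).
Proof.
  intros H1 H2 F; pose proof PI_RGT_0 as Hpi.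
  assert (FF : Filter F) by (apply within_filter, locally_filter).
  set (a := u1 + nu).
  set (dom := fun p : R * R => 0 < a /\ a < fst p + nu /\ fst p + nu < snd p + nu).
  assert (Hdom : forall P : R * R -> Prop, (forall p, dom p -> P p) -> F P).
  { intros P HP; apply within_always; [apply locally_filter|].
    intros p Hp; apply HP; unfold dom, a; lra. }
  assert (Hb : tends F (fun p => fst p + nu) (v + nu)) by apply tends_fst.
  assert (Hc : tends F (fun p => snd p + nu) (v + nu)) by apply tends_snd.
  assert (Hm : tends F (fun p => modulus_sq a (fst p + nu) (snd p + nu)) 1).
  { unfold modulus_sq; tends_auto. 
    - unfold a; apply Rgt_not_eq, Rmult_lt_0_compat; lra.
    - unfold a; field; lra. }
  assert (Hn : tends F (fun p => charac a (fst p + nu)) ((v - u1) / (v + nu))).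
  { unfold charac; tends_auto; [lra|unfold a; field; lra]. }
  assert (HN : tends F (fun p => / (1 - charac a (fst p + nu))) ((v + nu) / a)).
  { tends_auto; unfold a.
    - replace (1 - (v - u1) / (v + nu)) with ((u1 + nu) / (v + nu)) by (field; lra).
      apply Rgt_not_eq, Rdiv_lt_0_compat; lra.
    - field; lra. }
  assert (He : tends F (fun p => sqrt (1 - modulus_sq a (fst p + nu) (snd p + nu))) 0).
  { tends_auto; [lra|]. replace (1 - 1) with 0 by ring; apply sqrt_0. }
  assert (HDi : tends F (fun p => / ellD (modulus_sq a (fst p + nu) (snd p + nu))) 0).
  { apply (ellD_blowup F (fun p => modulus_sq a (fst p + nu) (snd p + nu))); [|exact He].
    apply Hdom; intros p [P1 [P2 P3]]; now apply modulus_sq_range. }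
  assert (HS : tends F (fun p => u1 + fst p + snd p + 2 * nu) (u1 + 2 * v + 2 * nu)).
  { apply (filterlim_ext (fun p : R * R => u1 + (fst p + nu) + (snd p + nu))); [intros; ring|].
    change (tends F (fun p => u1 + (fst p + nu) + (snd p + nu)) (u1 + 2 * v + 2 * nu)).
    tends_auto; ring. }
  assert (Hbound : tends F (fun p => 2 * (snd p + nu - a) * (2 * / (1 - charac a (fst p + nu)) *
      sqrt (1 - modulus_sq a (fst p + nu) (snd p + nu)))) 0).
  { tends_auto; ring. }
  split; [|split].
  (* With [ellK = ellB + ellD] and [0 < ellB <= 1], dividing the bounds of [ellPi_bounds] by [ellD]
     leaves [/ (1 - n)] up to multiples of [/ ellD], which vanish. *)
  - assert (HQ : tends F (fun p => ellPi (charac a (fst p + nu)) (modulus_sq a (fst p + nu) (snd p + nu))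
         * / ellD (modulus_sq a (fst p + nu) (snd p + nu))) ((v + nu) / a)).
    { apply (tends_squeeze F (fun p => / (1 - charac a (fst p + nu)) - charac a (fst p + nu) *
          (/ (1 - charac a (fst p + nu)) * / (1 - charac a (fst p + nu))) *
          / ellD (modulus_sq a (fst p + nu) (snd p + nu))) _
        (fun p => / (1 - charac a (fst p + nu)) *
          (1 + / ellD (modulus_sq a (fst p + nu) (snd p + nu)))) _ ((v + nu) / a)); [| | |reflexivity].
      - apply Hdom; intros p [P1 [P2 P3]].
        pose proof (charac_range _ _ P1 P2) as Rn; pose proof (modulus_sq_range _ _ _ P1 P2 P3) as Rm.
        set (n := charac _ _) in *; set (m := modulus_sq _ _ _) in *.
        destruct (ell_pos m Rm) as [HB [HD _]].
        destruct (ellPi_bounds n m ltac:(lra) ltac:(lra)) as [[_ HU] HL].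
        rewrite ellK_eq in HU, HL by lra.
        replace (/ (1 - n) ^ 2) with (/ (1 - n) * / (1 - n)) in HL by (field; lra).
        pose proof (ellB_bounds m ltac:(lra)) as HB1.
        assert (HN0 : 0 < / (1 - n)) by (apply Rinv_0_lt_compat; lra).
        assert (HD0 : 0 < / ellD m) by now apply Rinv_0_lt_compat.
        assert (HN2 : 0 < / (1 - n) * / (1 - n)) by now apply Rmult_lt_0_compat.
        set (N := / (1 - n)) in *; clearbody N n m.
        assert (Hi : ellD m * / ellD m = 1) by (field; lra).
        assert (0 <= n * (N * N) * (1 - ellB m)) by (repeat apply Rmult_le_pos; lra).
        assert (0 <= N * (1 - ellB m)) by (apply Rmult_le_pos; lra).
        assert (0 <= N * ellB m) by (apply Rmult_le_pos; lra).
        split.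
        + replace (N - n * (N * N) * / ellD m) with ((N * ellD m - n * (N * N)) * / ellD m)
            by (rewrite Rmult_minus_distr_r, Rmult_assoc, Hi; ring).
          apply Rmult_le_compat_r; lra.
        + replace (N * (1 + / ellD m)) with (N * (1 + ellD m) * / ellD m)
            by (rewrite !Rmult_plus_distr_l, Rmult_plus_distr_r, (Rmult_assoc N (ellD m)), Hi; ring).
          apply Rmult_le_compat_r; lra.
      - tends_auto; ring.
      - tends_auto; ring. }
    (* The limit [(v + nu) / a] of the quotient cancels the prefactor [a / c], and
       [u1 + 2 * v + 2 * nu - 2 * (v - u1)] is the stated value. *)
    apply (filterlim_within_ext _ (fun p => u1 + fst p + snd p + 2 * nu
        - 2 * a * (snd p + nu - a) / (snd p + nu) *
       (ellPi (charac a (fst p + nu)) (modulus_sq a (fst p + nu) (snd p + nu))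
         * / ellD (modulus_sq a (fst p + nu) (snd p + nu))))).
    + intros p [P1 P2]; destruct (Cspeed1_closed nu u1 (fst p) (snd p)) as [_ ->]; try lra.
      fold a; destruct (ell_pos (modulus_sq a (fst p + nu) (snd p + nu))) as [_ [HD _]];
        [apply modulus_sq_range; unfold a; lra|].
      field; lra.
    + change (tends F (fun p => u1 + fst p + snd p + 2 * nu
        - 2 * a * (snd p + nu - a) / (snd p + nu) *
       (ellPi (charac a (fst p + nu)) (modulus_sq a (fst p + nu) (snd p + nu))
         * / ellD (modulus_sq a (fst p + nu) (snd p + nu)))) (3 * u1 + 2 * nu)).
      tends_auto; [lra|unfold a; field; lra].
  - apply (tends_squeeze F (fun p => u1 + fst p + snd p + 2 * nu
        - 2 * (snd p + nu - a) * (2 * / (1 - charac a (fst p + nu)) *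
            sqrt (1 - modulus_sq a (fst p + nu) (snd p + nu)))) _
        (fun p => u1 + fst p + snd p + 2 * nu) _ (u1 + 2 * v + 2 * nu));
      [| |exact HS|reflexivity].
    + apply Hdom; intros p [P1 [P2 P3]].
      destruct (Cspeed2_closed nu u1 (fst p) (snd p)) as [_ ->]; try (unfold a in *; lra); fold a.
      pose proof (charac_range _ _ P1 P2) as Rn; pose proof (modulus_sq_range _ _ _ P1 P2 P3) as Rm.
      pose proof (compl_modulus_sq _ _ _ P1 P2 P3) as Hcp.
      set (b := fst p + nu) in *; set (c := snd p + nu) in *.
      pose proof (ellB_bounds (modulus_sq a b c) ltac:(lra)) as HB.
      destruct (soliton_estimate _ _ _ Rn Rm (proj1 HB)) as [L U].
      (* Since [a * (c - b) = (1 - m) * b * (c - a)], the correction takes the form of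
         [soliton_estimate], with an extra factor [b / c] below 1. *)
      replace (2 * a * (c - b) * ellPi (charac a b) (modulus_sq a b c) / (c * ellB (modulus_sq a b c)))
        with (2 * (c - a) * (b / c) * ((1 - modulus_sq a b c) * ellPi (charac a b) (modulus_sq a b c) / ellB (modulus_sq a b c)))
        by (rewrite Hcp; field; lra).
      assert (0 < b / c < 1) by (split; [apply Rdiv_lt_0_compat|apply Rlt_div_l]; lra).
      set (z := (1 - modulus_sq a b c) * _ / _) in *; set (r := b / c) in *; clearbody z r b c.
      split.
      * assert (2 * (c - a) * r * z <= 2 * (c - a) * z); [|nra].
        assert (0 <= (c - a) * z) by (apply Rmult_le_pos; lra). nra.
      * assert (0 <= 2 * (c - a) * r * z) by (repeat apply Rmult_le_pos; lra). lra.
    + tends_auto; ring.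
  - apply (tends_squeeze F (fun p => u1 + fst p + snd p + 2 * nu) _
      (fun p => u1 + fst p + snd p + 2 * nu
        + 2 * (snd p + nu - a) * (2 * / (1 - charac a (fst p + nu)) *
            sqrt (1 - modulus_sq a (fst p + nu) (snd p + nu)))) _ (u1 + 2 * v + 2 * nu));
      [|exact HS| |reflexivity].
    + apply Hdom; intros p [P1 [P2 P3]].
      destruct (Cspeed3_closed nu u1 (fst p) (snd p)) as [_ ->]; try (unfold a in *; lra); fold a.
      pose proof (charac_range _ _ P1 P2) as Rn; pose proof (modulus_sq_range _ _ _ P1 P2 P3) as Rm.
      pose proof (compl_modulus_sq _ _ _ P1 P2 P3) as Hcp.
      set (b := fst p + nu) in *; set (c := snd p + nu) in *.
      pose proof (ellB_bounds (modulus_sq a b c) ltac:(lra)) as HB.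
      pose proof (ellD_bounds (modulus_sq a b c) ltac:(lra)) as HD.
      assert (HE : PI / 4 <= ellE (modulus_sq a b c)).
      { rewrite ellE_eq by lra.
        assert (0 <= (1 - modulus_sq a b c) * ellD (modulus_sq a b c)) by (apply Rmult_le_pos; lra). lra. }
      destruct (soliton_estimate _ _ _ Rn Rm HE) as [L U].
      replace (2 * a * (c - b) * ellPi (charac a b) (modulus_sq a b c) / (b * ellE (modulus_sq a b c)))
        with (2 * (c - a) * ((1 - modulus_sq a b c) * ellPi (charac a b) (modulus_sq a b c) / ellE (modulus_sq a b c)))
        by (rewrite Hcp; field; lra).
      set (z := (1 - modulus_sq a b c) * _ / _) in *; clearbody z b c.
      split.
      * assert (0 <= 2 * (c - a) * z) by (repeat apply Rmult_le_pos; lra). lra.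
      * apply Rplus_le_compat_l, Rmult_le_compat_l; lra.
    + tends_auto; ring.
Qed.

(** Here [m] and [n] tend to 0, so [ellB] and [ellD] tend to [PI / 4], [ellE] and [ellPi] to
    [PI / 2]. The ratio of [PI / 2] to [PI / 4] turns the 2 of the first two speeds into the 4 in
    [l]; in the third speed the ratio is 1 and the correction tends to [2 * (u3 - w)]. *)
Lemma harmonic_limit nu w u3 : - nu < w -> w < u3 ->
  let F := within (fun p : R * R => - nu < fst p /\ fst p < snd p /\ snd p < u3)
             (locally (w, w)) in
  let l := 2 * w + u3 + 2 * nu - 4 * (w + nu) * (u3 - w) / (u3 + nu) in
  tends F (fun p => Cspeed3 nu (fst p) (snd p) u3) (3 * u3 + 2 * nu) /\
  tends F (fun p => Cspeed1 nu (fst p) (snd p) u3) l /\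
  tends F (fun p => Cspeed2 nu (fst p) (snd p) u3) l.
Proof.
  intros H1 H2 F l; pose proof PI_RGT_0 as Hpi.
  assert (FF : Filter F) by (apply within_filter, locally_filter).
  set (c := u3 + nu).
  set (dom := fun p : R * R => 0 < fst p + nu /\ fst p + nu < snd p + nu /\ snd p + nu < c).
  assert (Hdom : forall P : R * R -> Prop, (forall p, dom p -> P p) -> F P).
  { intros P HP; apply within_always; [apply locally_filter|].
    intros p Hp; apply HP; unfold dom, c; lra. }
  assert (Ha : tends F (fun p => fst p + nu) (w + nu)) by apply tends_fst.
  assert (Hb : tends F (fun p => snd p + nu) (w + nu)) by apply tends_snd.
  assert (Hm : tends F (fun p => modulus_sq (fst p + nu) (snd p + nu) c) 0).
  { unfold modulus_sq; tends_auto.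
    - unfold c; apply Rgt_not_eq, Rmult_lt_0_compat; lra.
    - unfold c; field; lra. }
  assert (Hn : tends F (fun p => charac (fst p + nu) (snd p + nu)) 0).
  { unfold charac; tends_auto; [lra|field; lra]. }
  assert (HN : tends F (fun p => / (1 - charac (fst p + nu) (snd p + nu))) 1).
  { tends_auto; [lra|field]. }
  assert (He : tends F (fun p => sqrt (1 - modulus_sq (fst p + nu) (snd p + nu) c)) 1).
  { tends_auto; [lra|]. rewrite Rminus_0_r; apply sqrt_1. }
  assert (He' : tends F (fun p => / sqrt (1 - modulus_sq (fst p + nu) (snd p + nu) c)) 1).
  { tends_auto; [lra|field]. }
  assert (HB : tends F (fun p => ellB (modulus_sq (fst p + nu) (snd p + nu) c)) (PI / 4)).
  { apply (tends_squeeze F (fun _ => PI / 4) _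
      (fun p => PI / 4 * / sqrt (1 - modulus_sq (fst p + nu) (snd p + nu) c)) _ (PI / 4));
      [|apply tends_const, FF| |reflexivity].
    - apply Hdom; intros p [P1 [P2 P3]]; pose proof (modulus_sq_range _ _ _ P1 P2 P3).
      split; [apply ellB_bounds|apply ellB_le]; lra.
    - tends_auto; ring. }
  assert (HD : tends F (fun p => ellD (modulus_sq (fst p + nu) (snd p + nu) c)) (PI / 4)).
  { apply (tends_squeeze F (fun _ => PI / 4) _
      (fun p => PI / 4 * / sqrt (1 - modulus_sq (fst p + nu) (snd p + nu) c)) _ (PI / 4));
      [|apply tends_const, FF| |reflexivity].
    - apply Hdom; intros p [P1 [P2 P3]]; pose proof (modulus_sq_range _ _ _ P1 P2 P3).
      apply ellD_bounds; lra.
    - tends_auto; ring. }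
  assert (HE : tends F (fun p => ellB (modulus_sq (fst p + nu) (snd p + nu) c) +
     (1 - modulus_sq (fst p + nu) (snd p + nu) c) * ellD (modulus_sq (fst p + nu) (snd p + nu) c)) (PI / 2)).
  { tends_auto; field. }
  assert (HP : tends F (fun p => ellPi (charac (fst p + nu) (snd p + nu))
      (modulus_sq (fst p + nu) (snd p + nu) c)) (PI / 2)).
  { apply (tends_squeeze F (fun p => ellB (modulus_sq (fst p + nu) (snd p + nu) c) +
         ellD (modulus_sq (fst p + nu) (snd p + nu) c)) _
      (fun p => / (1 - charac (fst p + nu) (snd p + nu)) *
       (ellB (modulus_sq (fst p + nu) (snd p + nu) c) +
         ellD (modulus_sq (fst p + nu) (snd p + nu) c))) _ (PI / 2)); [| | |reflexivity].
    - apply Hdom; intros p [P1 [P2 P3]].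
      pose proof (charac_range _ _ P1 P2) as Rn; pose proof (modulus_sq_range _ _ _ P1 P2 P3) as Rm.
      rewrite <- ellK_eq by lra.
      apply ellPi_bounds; lra.
    - tends_auto; field.
    - tends_auto; field. }
  assert (HS : tends F (fun p => fst p + snd p + u3 + 2 * nu) (2 * w + u3 + 2 * nu)).
  { apply (filterlim_ext (fun p : R * R => (fst p + nu) + (snd p + nu) + u3)); [intros; ring|].
    change (tends F (fun p => (fst p + nu) + (snd p + nu) + u3) (2 * w + u3 + 2 * nu)).
    tends_auto; ring. }
  split; [|split].
  - apply (filterlim_within_ext _ (fun p => fst p + snd p + u3 + 2 * nu
       + 2 * (fst p + nu) * (c - (snd p + nu)) *
         ellPi (charac (fst p + nu) (snd p + nu)) (modulus_sq (fst p + nu) (snd p + nu) c) /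
         ((snd p + nu) * (ellB (modulus_sq (fst p + nu) (snd p + nu) c) +
     (1 - modulus_sq (fst p + nu) (snd p + nu) c) * ellD (modulus_sq (fst p + nu) (snd p + nu) c))))).
    + intros p [P1 [P2 P3]]; destruct (Cspeed3_closed nu (fst p) (snd p) u3) as [_ ->]; try lra.
      fold c; rewrite ellE_eq; [reflexivity|].
      generalize (modulus_sq_range (fst p + nu) (snd p + nu) c); unfold c; lra.
    + tends_auto; [apply Rgt_not_eq, Rmult_lt_0_compat; unfold c; lra|unfold c; field; lra].
  - apply (filterlim_within_ext _ (fun p => fst p + snd p + u3 + 2 * nu
       - 2 * (fst p + nu) * (c - (fst p + nu)) *
         ellPi (charac (fst p + nu) (snd p + nu)) (modulus_sq (fst p + nu) (snd p + nu) c) /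
         (c * ellD (modulus_sq (fst p + nu) (snd p + nu) c)))).
    + intros p [P1 [P2 P3]]; destruct (Cspeed1_closed nu (fst p) (snd p) u3) as [_ ->]; try lra.
      reflexivity.
    + tends_auto; [apply Rgt_not_eq, Rmult_lt_0_compat; unfold c; lra|unfold l, c; field; lra].
  - apply (filterlim_within_ext _ (fun p => fst p + snd p + u3 + 2 * nu
       - 2 * (fst p + nu) * (c - (snd p + nu)) *
         ellPi (charac (fst p + nu) (snd p + nu)) (modulus_sq (fst p + nu) (snd p + nu) c) /
         (c * ellB (modulus_sq (fst p + nu) (snd p + nu) c)))).
    + intros p [P1 [P2 P3]]; destruct (Cspeed2_closed nu (fst p) (snd p) u3) as [_ ->]; try lra.
      reflexivity.
    + tends_auto; [apply Rgt_not_eq, Rmult_lt_0_compat; unfold c; lra|unfold l, c; field; lra].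
Qed.

(** * Assembly of the formulas, the ordering and the limits *)

Theorem theorem2 :
  forall nu : R,
  (* part 1: explicit formulas (with the partial derivatives existing and d k / d u^i <> 0) *)
  (forall u1 u2 u3 : R, - nu < u1 -> u1 < u2 -> u2 < u3 ->
     let s := smod nu u1 u2 u3 in
     let rho := rhop nu u1 u2 in
     let S := u1 + u2 + u3 + 2 * nu in
     let L := Lam (Kell s) rho s in
     (ex_derive (fun x => kwave nu x u2 u3) u1 /\ ex_derive (fun x => omega nu x u2 u3) u1 /\
      Derive (fun x => kwave nu x u2 u3) u1 <> 0 /\
      ex_derive (fun x => kwave nu u1 x u3) u2 /\ ex_derive (fun x => omega nu u1 x u3) u2 /\
      Derive (fun x => kwave nu u1 x u3) u2 <> 0 /\
      ex_derive (fun x => kwave nu u1 u2 x) u3 /\ ex_derive (fun x => omega nu u1 u2 x) u3 /\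
      Derive (fun x => kwave nu u1 u2 x) u3 <> 0) /\
     Cspeed1 nu u1 u2 u3 =
       S + 2 * (u1 + nu) * (u1 - u2) * L / ((u2 + nu) * (Kell s - Eell s)) /\
     Cspeed2 nu u1 u2 u3 =
       S + 2 * (u2 - u1) * L /
         (Kell s - (u2 + nu) * (u3 - u1) / ((u1 + nu) * (u3 - u2)) * Eell s) /\
     Cspeed3 nu u1 u2 u3 =
       S + 2 * (u1 + nu) * (u3 - u2) * L / ((u2 + nu) * Eell s) /\
     (* part 2: ordering of the characteristic speeds *)
     Cspeed1 nu u1 u2 u3 < Cspeed3 nu u1 u2 u3 /\ Cspeed2 nu u1 u2 u3 < Cspeed3 nu u1 u2 u3) /\
  (* part 3a: u2, u3 -> v *)
  (forall u1 v : R, - nu < u1 -> u1 < v ->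
     filterlim (fun p : R * R => Cspeed1 nu u1 (fst p) (snd p))
       (within (fun p : R * R => u1 < fst p /\ fst p < snd p) (locally (v, v)))
       (locally (3 * u1 + 2 * nu)) /\
     exists l : R,
       filterlim (fun p : R * R => Cspeed2 nu u1 (fst p) (snd p))
         (within (fun p : R * R => u1 < fst p /\ fst p < snd p) (locally (v, v)))
         (locally l) /\
       filterlim (fun p : R * R => Cspeed3 nu u1 (fst p) (snd p))
         (within (fun p : R * R => u1 < fst p /\ fst p < snd p) (locally (v, v)))
         (locally l)) /\
  (* part 3b: u1, u2 -> w *)
  (forall w u3 : R, - nu < w -> w < u3 ->
     filterlim (fun p : R * R => Cspeed3 nu (fst p) (snd p) u3)
       (within (fun p : R * R => - nu < fst p /\ fst p < snd p /\ snd p < u3) (locally (w, w)))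
       (locally (3 * u3 + 2 * nu)) /\
     exists l : R,
       filterlim (fun p : R * R => Cspeed1 nu (fst p) (snd p) u3)
         (within (fun p : R * R => - nu < fst p /\ fst p < snd p /\ snd p < u3) (locally (w, w)))
         (locally l) /\
       filterlim (fun p : R * R => Cspeed2 nu (fst p) (snd p) u3)
         (within (fun p : R * R => - nu < fst p /\ fst p < snd p /\ snd p < u3) (locally (w, w)))
         (locally l)).

Proof.
  intros nu; split; [|split].
  - intros u1 u2 u3 H1 H2 H3 s rho S L.
    destruct (Cspeed1_closed nu u1 u2 u3 H1 H2 H3) as [[E11 [E12 E13]] E1].
    destruct (Cspeed2_closed nu u1 u2 u3 H1 H2 H3) as [[E21 [E22 E23]] E2].
    destruct (Cspeed3_closed nu u1 u2 u3 H1 H2 H3) as [[E31 [E32 E33]] E3].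
    pose proof (smod_sq nu u1 u2 u3 H1 H2 H3) as Hs.
    pose proof (rhop_sq nu u1 u2 H1 H2) as Hr.
    fold s in Hs; fold rho in Hr.
    assert (Ha : 0 < u1 + nu) by lra; assert (Hb : u1 + nu < u2 + nu) by lra;
      assert (Hc : u2 + nu < u3 + nu) by lra.
    pose proof (modulus_sq_range _ _ _ Ha Hb Hc) as Hm; pose proof (charac_range _ _ Ha Hb) as Hn.
    pose proof (compl_modulus_sq _ _ _ Ha Hb Hc) as Hcm.
    assert (HL : L = ellPi (charac (u1 + nu) (u2 + nu)) (modulus_sq (u1 + nu) (u2 + nu) (u3 + nu)))
      by (unfold L; rewrite Lam_complete, Hs, Hr; rewrite ?Hs, ?Hr; lra).
    (* The two forms are convertible, so the modulus enters only through its square. *)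
    change (Kell s) with (ellK (s ^ 2)); change (Eell s) with (ellE (s ^ 2)); rewrite Hs.
    rewrite <- HL in E1, E2, E3.
    pose proof (ellPi_pos _ _ Hn Hm) as HL0; rewrite <- HL in HL0.
    assert (Hmv : modulus_sq (u1 + nu) (u2 + nu) (u3 + nu) =
       (u3 + nu) * (u2 - u1) / ((u2 + nu) * (u3 - u1))) by (unfold modulus_sq; field; lra).
    destruct (ell_pos _ Hm) as [HB [HD [HE HK]]].
    set (m := modulus_sq _ _ _) in *; clearbody m L; clear HL.
    assert (HKE : ellK m - ellE m = m * ellD m) by (rewrite ellK_eq, ellE_eq by lra; ring).
    assert (HEK : ellK m - (u2 + nu) * (u3 - u1) / ((u1 + nu) * (u3 - u2)) * ellE m =
       - (m * (u2 + nu) * (u3 - u1) / ((u1 + nu) * (u3 - u2))) * ellB m).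
    (* The coefficient of [E] in the second formula is [/ (1 - m)]; the denominator is thus
       [- m * ellB m / (1 - m)]. *)
    { replace ((u2 + nu) * (u3 - u1) / ((u1 + nu) * (u3 - u2))) with (/ (1 - m))
        by (rewrite Hcm; field; lra).
      replace (m * (u2 + nu) * (u3 - u1) / ((u1 + nu) * (u3 - u2))) with (m * / (1 - m))
        by (rewrite Hcm; field; lra).
      rewrite ellK_eq, ellE_eq by lra; field; lra. }
    (* All three corrections to the phase velocity have this shape: subtracted in the first two
       speeds, added in the third, which settles both inequalities. *)
    assert (Hpos : forall x y z t : R, 0 < x -> 0 < y -> 0 < z -> 0 < t ->
              0 < 2 * x * y * L / (z * t)).
    { intros; apply Rdiv_lt_0_compat; repeat apply Rmult_lt_0_compat; lra. }
    split; [now repeat split|].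
    split; [|split; [|split; [|split]]].
    + rewrite E1, HKE; unfold S; set (d := ellD m) in *; clearbody d.
      rewrite Hmv; field; lra.
    + rewrite E2, HEK; unfold S; set (d := ellB m) in *; clearbody d.
      rewrite Hmv; field; lra.
    + rewrite E3; unfold S.
      replace (u3 + nu - (u2 + nu)) with (u3 - u2) by ring; reflexivity.
    + rewrite E1, E3.
      pose proof (Hpos (u1 + nu) (u3 + nu - (u1 + nu)) (u3 + nu) (ellD m)
        ltac:(lra) ltac:(lra) ltac:(lra) HD).
      pose proof (Hpos (u1 + nu) (u3 + nu - (u2 + nu)) (u2 + nu) (ellE m)
        ltac:(lra) ltac:(lra) ltac:(lra) HE).
      lra.
    + rewrite E2, E3.
      pose proof (Hpos (u1 + nu) (u3 + nu - (u2 + nu)) (u3 + nu) (ellB m)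
        ltac:(lra) ltac:(lra) ltac:(lra) HB).
      pose proof (Hpos (u1 + nu) (u3 + nu - (u2 + nu)) (u2 + nu) (ellE m)
        ltac:(lra) ltac:(lra) ltac:(lra) HE).
      lra.
  - intros u1 v H1 H2; destruct (soliton_limit nu u1 v H1 H2) as [L1 [L2 L3]].
    split; [exact L1|]; exists (u1 + 2 * v + 2 * nu); split; assumption.
  - intros w u3 H1 H2; destruct (harmonic_limit nu w u3 H1 H2) as [L3 [L1 L2]].
    split; [exact L3|]; eexists; split; [exact L1|exact L2].
Qed.
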